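(* Let $d=d(n)=o(n)$, let $G=G_n$ be a known $d$-regular graph on $n$ vertices with adjacency matrix $A$, let $\beta_{\mathsf{max}},h_{\mathsf{max}}\in[0,\infty)$ be fixed constants, and let $L_n$ be any positive sequence diverging to infinity. Given data in $\{-1,1\}^n$, consider testing - $H_0$: the data is drawn from the Curie-Weiss model with some unknown $(\beta^{\mathrm{CW}},h^{\mathrm{CW}})$ with $0\le\beta^{\mathrm{CW}}\le\beta_{\mathsf{max}}$ and $|h^{\mathrm{CW}}|\le h_{\mathsf{max}}$; - $H_1$: the data is drawn from the Ising model on $G$ with some unknown $(\beta^{\mathrm{dreg}}_n,h^{\mathrm{dreg}})\in\Lambda_{\mathsf{Ising}}$. 1. If $\Lambda_{\mathsf{Ising}}=\{(\beta^{\mathrm{dreg}}_n,h^{\mathrm{dreg}}):\beta^{\mathrm{dreg}}_n\ge\frac{L_n}{\sqrt{nd}},\ |h^{\mathrm{dreg}}|\le h_{\mathsf{max}}\}$, then for some choice of $T_n=T_n(\beta_{\mathsf{max}},h_{\mathsf{max}},L_n)\to\infty$ the canonical test $\mathcal{T}(T_n,\kappa_{\mathsf{Ising}})$ with $\kappa_{\mathsf{Ising}}(x)=x^{\intercal}Ax$, which (besides the known graph) depends only on $\beta_{\mathsf{max}}$, $h_{\mathsf{max}}$ and $L_n$ and not on the unknown parameters, distinguishes $H_0$ and $H_1$ with high probability from a single sample. 2. If $\Lambda_{\mathsf{Ising}}=\{(\beta^{\mathrm{dreg}}_n,h^{\mathrm{dreg}}):\beta^{\mathrm{dreg}}_n=\frac{1}{L_n\sqrt{nd}},\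 |h^{\mathrm{dreg}}|\le h_{\mathsf{max}}\}$, then there is no statistical test which can distinguish $H_0$ and $H_1$ with high probability using a constant number of i.i.d. samples.
   Context: Models on $\{-1,1\}^n$, with $m(x)=\frac1n\sum_{i=1}^n x_i$: the Curie-Weiss model with parameters $(\beta^{\mathrm{CW}},h^{\mathrm{CW}})$ is $p(x)\propto\exp\big(\frac n2\beta^{\mathrm{CW}}m(x)^2+nh^{\mathrm{CW}}m(x)\big)$; the Ising model on $G$ with parameters $(\beta^{\mathrm{dreg}},h^{\mathrm{dreg}})$ is $q(x)\propto\exp\big(\frac{\beta^{\mathrm{dreg}}}{2}x^{\intercal}Ax+nh^{\mathrm{dreg}}m(x)\big)$. A test (sequence) based on $k$ i.i.d. samples is a sequence of decision functions from $(\{-1,1\}^n)^k$ to $\{H_0,H_1\}$. Its risk is the supremum over all admissible parameters under $H_0$ and all admissible parameters under $H_1$ of the maximum of the two error probabilities (deciding $H_1$ under $H_0$, deciding $H_0$ under $H_1$). It distinguishes $H_0$ and $H_1$ with high probability if its risk tends to $0$ as $n\to\infty$. ''Constant number'' means $k$ is fixed independently of $n$. Canonical test: let $M_n=\{-1,-1+\frac2n,\dots,1-\frac2n,1\}$ and for $m_0\in M_n$ let $A_{m_0}=\{x\in\{-1,1\}^n:m(x)=m_0\}$. Fix $\epsilon>0$ (and constants $B,C>0$), depending only on $\beta_{\mathsf{max}},h_{\mathsf{max}}$, such that $p(m(x)\in[-1+\epsilon,1-\epsilon])\ge1-Be^{-Cn}$ for every Curie-Weiss model $p$ allowed under $H_0$,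 and set $S_n=M_n\cap[-1+\epsilon,1-\epsilon]$. For a function $\kappa$ let $e_{m_0}(\kappa)$ and $\sigma^2_{m_0}(\kappa)$ be the mean and variance of $\kappa(X)$ for $X$ uniform on $A_{m_0}$. The canonical test $\mathcal{T}(T,\kappa)$ decides $H_1$ on input $X$ if $m(X)\notin S_n$, or if $m(X)\in S_n$ and $\frac{\kappa(X)-e_{m(X)}(\kappa)}{\sigma_{m(X)}(\kappa)}\ge T$; otherwise it decides $H_0$. *)

(* Defs.v *)
From mathcomp Require Import all_boot all_order all_algebra.
From mathcomp Require Import all_classical all_reals all_analysis.

Set Implicit Arguments.
Unset Strict Implicit.
Unset Printing Implicit Defensive.

Import Order.TTheory GRing.Theory Num.Theory.
Import numFieldNormedType.Exports.

Local Open Scope classical_set_scope.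
Local Open Scope ring_scope.

(* The cube {-1,1}^n: [true] stands for the spin 1 and [false] for -1. *)
Definition config (n : nat) := {ffun 'I_n -> bool}.

Section Models.
Context {R : realType}.

Definition spin (b : bool) : R := if b then 1 else -1.

Definition spins n (x : config n) : 'cV[R]_n := \col_i spin (x i).

Definition magn n (x : config n) : R := n%:R^-1 * \sum_(i < n) spin (x i).

Definition adjacency n (e : rel 'I_n) : 'M[R]_n := \matrix_(i, j) (e i j)%:R.

Definition kappa_Ising n (e : rel 'I_n) (x : config n) : R :=
  ((spins x)^T *m adjacency e *m spins x) 0 0.

(* The probability mass function proportional to exp(H). *)
Definition gibbs n (H : config n -> R) (x : config n) : R :=
  expR (H x) / \sum_(y : config n) expR (H y).

(* Parameters are pairs (beta, h). *)
Definition curie_weiss n (theta : R * R) : config n -> R :=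
  gibbs (fun x => n%:R / 2 * theta.1 * magn x ^+ 2 + n%:R * theta.2 * magn x).

Definition ising n (e : rel 'I_n) (theta : R * R) : config n -> R :=
  gibbs (fun x => theta.1 / 2 * kappa_Ising e x + n%:R * theta.2 * magn x).

Definition Pr n (p : config n -> R) (E : pred (config n)) : R :=
  \sum_(x | E x) p x.

Definition Pr_iid n k (p : config n -> R) (E : pred (k.-tuple (config n))) : R :=
  \sum_(s | E s) \prod_(i < k) p (tnth s i).

(* A decision function on k samples returns [true] to decide H_1 and [false]
   to decide H_0. *)
Definition decision n k := k.-tuple (config n) -> bool.

Definition risk n k (p q : R * R -> config n -> R) (Lambda0 Lambda1 : set (R * R))
    (t : decision n k) : R :=
  sup [set Num.max (Pr_iid (p theta0) (fun s => t s))
                   (Pr_iid (q theta1) (fun s => ~~ t s))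
      | theta0 in Lambda0 & theta1 in Lambda1].

Definition Lambda_CW (bmax hmax : R) : set (R * R) :=
  [set theta | 0 <= theta.1 <= bmax /\ `|theta.2| <= hmax].

Definition Lambda_strong (hmax : R) (n d : nat) (l : R) : set (R * R) :=
  [set theta | l / Num.sqrt (n * d)%:R <= theta.1 /\ `|theta.2| <= hmax].

Definition Lambda_weak (hmax : R) (n d : nat) (l : R) : set (R * R) :=
  [set theta | theta.1 = 1 / (l * Num.sqrt (n * d)%:R) /\ `|theta.2| <= hmax].

Definition magn_values (n : nat) : seq R :=
  [seq -1 + 2 * j%:R / n%:R | j <- iota 0 n.+1].

Definition magn_bulk (eps : R) (n : nat) : seq R :=
  [seq m0 <- magn_values n | -1 + eps <= m0 <= 1 - eps].

Definition slice n (m0 : R) : {set config n} := [set x | magn x == m0]%SET.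

Definition slice_mean n (m0 : R) (kappa : config n -> R) : R :=
  (\sum_(x in slice n m0) kappa x) / #|slice n m0|%:R.

Definition slice_var n (m0 : R) (kappa : config n -> R) : R :=
  slice_mean m0 (fun x => (kappa x - slice_mean m0 kappa) ^+ 2).

(* On a slice where kappa is constant the quotient is 0 (division by 0). *)
Definition canonical_test (eps : R) n (T : R) (kappa : config n -> R)
    (x : config n) : bool :=
  (magn x \notin magn_bulk eps n) ||
  (T <= (kappa x - slice_mean (magn x) kappa)
        / Num.sqrt (slice_var (magn x) kappa)).

Definition single_sample n (t : config n -> bool) : decision n 1 :=
  fun s => t (thead s).

Definition admissible_eps (bmax hmax eps : R) : Prop :=
  0 < eps /\
  exists B C : R, [/\ 0 < B, 0 < C &
    forall n theta, (0 < n)%N -> Lambda_CW bmax hmax theta ->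
      1 - B * expR (- (C * n%:R)) <=
      Pr (curie_weiss (n := n) theta)
         (fun x => - 1 + eps <= magn x <= 1 - eps)].

(* Every limit is along the set I of sizes n for which the graphs are given: a
   d-regular graph on n vertices need not exist for all n (n * d is even). *)
Definition distinguishes (I : set nat) k
    (p q : forall n, R * R -> config n -> R)
    (Lambda0 Lambda1 : nat -> set (R * R)) (t : forall n, decision n k) : Prop :=
  risk (@p n) (@q n) (Lambda0 n) (Lambda1 n) (t n) @[n --> within I \oo] --> 0.

Definition positive_divergent (I : set nat) (L : nat -> R) : Prop :=
  (forall n, I n -> 0 < L n) /\ L n @[n --> within I \oo] --> +oo.

End Models.

Definition regular_graph n (d : nat) (e : rel 'I_n) : Prop :=
  [/\ symmetric e, irreflexive e & forall i, #|[set j | e i j]%SET| = d].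

(* Main.v *)
Require Import Defs.
From mathcomp Require Import all_boot all_order all_algebra.
From mathcomp Require Import all_classical all_reals all_analysis.
From mathcomp Require Import perm ring lra.
Import Order.TTheory GRing.Theory Num.Theory.
Import numFieldNormedType.Exports.
Set Implicit Arguments.
Unset Strict Implicit.
Unset Printing Implicit Defensive.
Local Open Scope classical_set_scope.
Local Open Scope ring_scope.

(** Let kappa(x) = x^T A x and D = sqrt(nd).  Both halves rest on one device.
    Take a finite set of configurations carrying involutions [tau_a], and write
    [jump f a x] for f(x) - f(tau_a x).  Pairing x with tau_a x turns
    sum_x e^(t kappa) sum_a jump f a into
    1/2 sum_x e^(t kappa) sum_a jump f a * (1 - e^(-t jump kappa a)),
    which for small t is controlled by the squared jumps of f and kappa
    ([tilted_sum_jump_le], [tilted_sum_jump_self_ge]).  Quadratic forms attached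
    to a regular graph are, up to an additive constant, eigenfunctions of
    f |-> sum_a jump f a, so the identity computes their tilted means.  It is
    applied to kappa itself and to the energy |A x|^2, which governs the sum of
    the squared jumps of kappa and closes the estimates.

    Weak coupling.  Take the moves to be the n spin flips and compare the Ising
    law q at h = 0 with the uniform law p, the Curie-Weiss law at (0, 0).  The
    energy has tilted mean at most 2nd, hence kappa has tilted mean at most
    8 t n d ([tilted_flip_kappa_le]) for t = beta/2.  The symmetrized relative
    entropy of p and q equals t E_q kappa <= 8 t^2 n d = 2 / L^2, so the overlap
    sum min(p, q) is at least 1 - 1/L.  Overlap is supermultiplicative over
    samples, which bounds the risk of every test on k samples below by a
    positive constant ([weak_coupling_undetectable]).

    Strong coupling.  Conditionally on the magnetization the Curie-Weiss law is
    uniform on a slice and the Ising law is proportional to e^(beta kappa / 2).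
    On a slice the moves are the swaps of two sites.  The centred kappa is an
    exact eigenfunction, whence its variance is at most 32 n d
    ([slice_sum_sqr_le]), and the false alarm bound is Chebyshev's inequality on
    each slice.  In the other direction, tilting by t0 = b / D with b large but
    t0 d small moves the mean of kappa up by at least a multiple of b D
    ([tilted_swap_kappa_ge]); this is where d = o(n) enters.  By Jensen's
    inequality every stronger tilt t >= 2 t0 then gives probability at most
    e^(-c b^2) to kappa being below the middle of that gap
    ([tilted_lower_tail], [slice_miss_le]), uniformly in beta.  The threshold T
    is a multiple of b = [tilt_scale], the largest value allowed by L and n/d.

    That the magnetization stays away from +-1 under Curie-Weiss laws follows
    by comparing flips: for small a / n, the mass of the configurations with fewer
    than a spins of one sign is at most 1/e times the mass of those with fewer
    than a + 1 ([lower_tail_decay]). *)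

(** * Elementary inequalities and sums over reversible moves *)
Section Elementary.
Context {R : realType}.
Implicit Types s a b x y : R.

Lemma normr_1BexpRN s : `|s| <= 2^-1 -> `|1 - expR (- s)| <= 2 * `|s|.
Proof.
move=> hs; have [s0|s0] := leP 0 s.
  rewrite ger0_norm in hs *; last exact: s0.
  have h1 : expR (- s) <= 1 by rewrite expR_le1; lra.
  have := expR_ge1Dx (- s); rewrite ger0_norm; lra.
rewrite ltr0_norm // in hs *.
have h1 : 1 <= expR (- s) by have := expR_ge1Dx (- s); lra.
rewrite ler0_norm ?subr_le0 //.
have h2 := expR_ge1Dx s.
have h3 : expR (- s) * expR s = 1 by rewrite -expRD addNr expR0.
have h4 := expR_gt0 (- s).
nra.
Qed.

Lemma ger_1BexpRN s : `|s| <= 2^-1 -> s ^+ 2 / 2 <= s * (1 - expR (- s)).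
Proof.
move=> hs; have [s0|s0] := leP 0 s.
  rewrite ger0_norm // in hs.
  have h2 := expR_ge1Dx s.
  have h3 : expR (- s) * expR s = 1 by rewrite -expRD addNr expR0.
  have h4 := expR_gt0 (- s).
  have h5 : s / 2 <= 1 - expR (- s) by nra.
  rewrite expr2; nra.
have := expR_ge1Dx (- s); rewrite expr2; nra.
Qed.

(** Pointwise comparison of the symmetrized relative entropy with the
    triangular discrimination; it replaces Pinsker's inequality. *)
Lemma expR_monotone_sub_ge a b :
  (expR b - expR a) ^+ 2 / (expR a + expR b) <= (expR b - expR a) * (b - a).
Proof.
have ha := expR_gt0 a; have hb := expR_gt0 b.
rewrite ler_pdivrMr ?addr_gt0 // expr2 -mulrA.
have ea : expR a = expR b * expR (a - b) by rewrite -expRD addrC subrK.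
have eb : expR b = expR a * expR (b - a) by rewrite -expRD addrC subrK.
have [ab|/ltW ab] := leP a b.
  have h1 : expR a <= expR b by rewrite ler_expR.
  apply: ler_wpM2l; first by rewrite subr_ge0.
  have h2 := expR_ge1Dx (a - b).
  nra.
have h1 : expR b <= expR a by rewrite ler_expR.
apply: ler_wnM2l; first by rewrite subr_le0.
have h2 := expR_ge1Dx (b - a).
nra.
Qed.

Lemma sum_delta (I : finType) (u : I) (f : I -> R) :
  \sum_i (i == u)%:R * f i = f u.
Proof.
rewrite (bigD1 u) //= eqxx mul1r big1 ?addr0 // => i /negPf ->.
by rewrite mul0r.
Qed.

End Elementary.

Section ReversibleMoves.
Context {R : realType} {T J : finType}.
Variables (S : {set T}) (move : J -> T -> T).
Hypothesis moveK : forall a, involutive (move a).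
Hypothesis move_in : forall a x, (move a x \in S) = (x \in S).

Definition jump (f : T -> R) (a : J) (x : T) : R := f x - f (move a x).

Lemma sum_move a (g : T -> R) : \sum_(x in S) g (move a x) = \sum_(x in S) g x.
Proof.
rewrite [RHS](reindex_inj (inv_inj (moveK a))) /=.
by apply: eq_bigl => x; rewrite move_in.
Qed.

(** Summation by parts: reindexing by the involution [move a] changes the sign
    of [jump f a], so only the antisymmetric part of G contributes. *)
Lemma sum_jump_symmetrize (G f : T -> R) :
  \sum_(x in S) G x * \sum_a jump f a x =
  2^-1 * \sum_(x in S) \sum_a jump G a x * jump f a x.
Proof.
under eq_bigr do rewrite mulr_sumr.
rewrite exchange_big [in RHS]exchange_big /= mulr_sumr.
apply: eq_bigr => a _.
have -> : \sum_(x in S) jump G a x * jump f a x =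
    \sum_(x in S) G x * jump f a x + \sum_(x in S) G (move a x) * jump f a (move a x).
  rewrite -big_split /=; apply: eq_bigr => x _; rewrite /jump moveK; ring.
by rewrite (sum_move a (fun x => G x * jump f a x)); lra.
Qed.

Variables (k : T -> R) (t : R).
Hypothesis t_ge0 : 0 <= t.
Hypothesis small : forall a x, x \in S -> `|t * jump k a x| <= 2^-1.

Let w x := expR (t * k x).

Let jump_w a x : jump w a x = w x * (1 - expR (- (t * jump k a x))).
Proof.
rewrite /jump /w mulrBr mulr1 -expRD; congr (_ - expR _); ring.
Qed.

(** Since w(x) - w(move a x) = w(x) (1 - e^(-t jump k a x)), the symmetrized sum
    gains a factor t; the product of the jumps of f and k is then split by the
    arithmetic-geometric inequality, the weight c being free. *)
Lemma tilted_sum_jump_le (f : T -> R) (c : R) : 0 < c ->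
  `|\sum_(x in S) w x * \sum_a jump f a x| <=
  t / 2 * \sum_(x in S) w x *
    (c^-1 * \sum_a jump f a x ^+ 2 + c * \sum_a jump k a x ^+ 2).
Proof.
move=> c0; rewrite sum_jump_symmetrize normrM ger0_norm ?invr_ge0 //.
rewrite [t / 2]mulrC -mulrA ler_pM2l ?invr_gt0 //.
rewrite mulr_sumr (le_trans (ler_norm_sum _ _ _)) // ler_sum // => x xS.
rewrite (le_trans (ler_norm_sum _ _ _)) // !mulr_sumr -big_split /= !mulr_sumr.
apply: ler_sum => a _.
rewrite jump_w !normrM ger0_norm ?expR_ge0 // -/(w x).
have h := normr_1BexpRN (small a xS).
rewrite normrM (ger0_norm t_ge0) in h.
rewrite mulrCA -mulrA ler_pM2l ?expR_gt0 //.
set u := jump f a x; set v := jump k a x in h *.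
rewrite -(real_normK (num_real u)) -(real_normK (num_real v)).
have hu := normr_ge0 u; have hv := normr_ge0 v.
have amgm : 2 * `|u| * `|v| <= c^-1 * `|u| ^+ 2 + c * `|v| ^+ 2.
  rewrite -subr_ge0.
  have -> : c^-1 * `|u| ^+ 2 + c * `|v| ^+ 2 - 2 * `|u| * `|v|
            = c^-1 * (`|u| - c * `|v|) ^+ 2 by field; rewrite gt_eqF.
  by rewrite mulr_ge0 ?sqr_ge0 // invr_ge0 ltW.
apply: (le_trans (y := 2 * (t * `|v|) * `|u|)); first by rewrite ler_wpM2r.
have -> : 2 * (t * `|v|) * `|u| = t * (2 * `|u| * `|v|) by ring.
by rewrite ler_wpM2l.
Qed.

(** For f = k the symmetrized terms s (1 - e^(-s)), s = t jump k a x, are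
    nonnegative and at least s^2 / 2, hence a lower bound. *)
Lemma tilted_sum_jump_self_ge :
  t / 4 * \sum_(x in S) w x * \sum_a jump k a x ^+ 2 <=
  \sum_(x in S) w x * \sum_a jump k a x.
Proof.
rewrite sum_jump_symmetrize.
have -> : t / 4 = 2^-1 * (t / 2) by field.
rewrite -mulrA ler_pM2l ?invr_gt0 // mulr_sumr.
apply: ler_sum => x xS; rewrite !mulr_sumr; apply: ler_sum => a _.
rewrite jump_w.
have h := ger_1BexpRN (small a xS).
set v := jump k a x in h *.
rewrite [leLHS](_ : _ = w x * (t / 2 * v ^+ 2)); last by ring.
rewrite -[leRHS]mulrA ler_pM2l ?expR_gt0 //.
have [->|t0] := eqVneq t 0.
  by rewrite !mul0r oppr0 expR0 subrr mul0r.
have tp : 0 < t by rewrite lt0r t0.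
rewrite -(ler_pM2l tp).
rewrite [leRHS](_ : _ = t * v * (1 - expR (- (t * v)))); last by ring.
by apply: le_trans h; rewrite le_eqVlt; apply/orP; left; apply/eqP; field.
Qed.

End ReversibleMoves.

(** * Quadratic forms and regular graphs *)

Section QuadraticForms.
Context {R : realType} {n : nat}.
Implicit Types (B : 'I_n -> 'I_n -> R) (y z g : 'I_n -> R).

Definition mulv B y (i : 'I_n) : R := \sum_j B i j * y j.

Definition qform B y : R := \sum_i y i * mulv B y i.

Lemma eq_mulv B y z : y =1 z -> mulv B y =1 mulv B z.
Proof. by move=> yz i; apply: eq_bigr => j _; rewrite yz. Qed.

Lemma eq_qform B y z : y =1 z -> qform B y = qform B z.
Proof. by move=> yz; apply: eq_bigr => i _; rewrite yz (eq_mulv B yz). Qed.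

Lemma mulvB B y z i : mulv B (fun j => y j - z j) i = mulv B y i - mulv B z i.
Proof. by rewrite /mulv -sumrB; apply: eq_bigr => j _; rewrite mulrBr. Qed.

Lemma qformB B y z : (forall i j, B i j = B j i) ->
  qform B (fun i => y i - z i) =
  qform B y - 2 * \sum_i z i * mulv B y i + qform B z.
Proof.
move=> Bsym.
have sw : \sum_i y i * mulv B z i = \sum_i z i * mulv B y i.
  rewrite /mulv; under eq_bigr do rewrite mulr_sumr.
  under [RHS]eq_bigr do rewrite mulr_sumr.
  rewrite exchange_big; apply: eq_bigr => i _; apply: eq_bigr => j _.
  by rewrite (Bsym i j); ring.
have -> : qform B (fun i => y i - z i) =
    qform B y - \sum_i z i * mulv B y i - \sum_i y i * mulv B z i + qform B z.
  rewrite /qform -!sumrB -big_split /=; apply: eq_bigr => i _.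
  by rewrite mulvB; ring.
by rewrite sw; ring.
Qed.

(** Exchanging two coordinates subtracts a multiple of e_u - e_v from y, so the
    change of the form is read off from its second order expansion. *)
Lemma qform_swapB B y u v (y' : 'I_n -> R) : (forall i j, B i j = B j i) ->
  y' =1 (fun i => y (tperm u v i)) ->
  qform B y - qform B y' =
  2 * (y u - y v) * (mulv B y u - mulv B y v)
  - (y u - y v) ^+ 2 * (B u u + B v v - 2 * B u v).
Proof.
move=> Bsym hy'; set a := y u - y v.
pose z i := a * ((i == u)%:R - (i == v)%:R).
have yz : y' =1 (fun i => y i - z i).
  move=> i; rewrite hy' /z /a; case: tpermP => [->|->|/eqP/negPf -> /eqP/negPf ->].
  - rewrite eqxx; case: (eqVneq u v) => [->|_]; rewrite /=; ring.
  - rewrite eqxx; case: (eqVneq v u) => [->|_]; rewrite /=; ring.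
  - by rewrite subrr mulr0 subr0.
have zf (f : 'I_n -> R) : \sum_i z i * f i = a * (f u - f v).
  rewrite -(sum_delta u f) -(sum_delta v f) -sumrB mulr_sumr.
  by apply: eq_bigr => i _; rewrite /z; ring.
rewrite (eq_qform B yz) qformB // zf /qform zf.
have mz i : mulv B z i = a * (B i u - B i v).
  by rewrite /mulv -zf; apply: eq_bigr => j _; rewrite mulrC.
by rewrite !mz (Bsym v u); ring.
Qed.

Lemma qform_flipB B y u (y' : 'I_n -> R) : (forall i j, B i j = B j i) ->
  y' =1 (fun i => if i == u then - y i else y i) ->
  qform B y - qform B y' = 4 * y u * mulv B y u - 4 * y u ^+ 2 * B u u.
Proof.
move=> Bsym hy'; pose z i := 2 * y u * (i == u)%:R.
have yz : y' =1 (fun i => y i - z i).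
  by move=> i; rewrite hy' /z; case: eqP => [->|_] /=; ring.
have zf (f : 'I_n -> R) : \sum_i z i * f i = 2 * y u * f u.
  rewrite -(sum_delta u f) mulr_sumr.
  by apply: eq_bigr => i _; rewrite /z; ring.
rewrite (eq_qform B yz) qformB // zf /qform zf.
have mz i : mulv B z i = 2 * y u * B i u.
  by rewrite /mulv -zf; apply: eq_bigr => j _; rewrite mulrC.
by rewrite !mz; ring.
Qed.

Lemma sum_pairs_subM y g :
  \sum_u \sum_v (y u - y v) * (g u - g v) =
  2 * n%:R * (\sum_i y i * g i) - 2 * (\sum_i y i) * (\sum_i g i).
Proof.
transitivity (\sum_u (n%:R * (y u * g u) - y u * (\sum_i g i)
                      - g u * (\sum_i y i) + \sum_i y i * g i)).
  apply: eq_bigr => u _.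
  have -> : n%:R * (y u * g u) = \sum_(v < n) y u * g u.
    by rewrite sumr_const card_ord mulr_natl.
  rewrite !mulr_sumr -!sumrB -big_split /=.
  by apply: eq_bigr => v _; ring.
rewrite big_split !sumrB /= -!mulr_suml -mulr_sumr sumr_const card_ord.
by rewrite -(mulr_natl _ n); ring.
Qed.

Lemma sum_pairs_sqr_sub B y (r : R) :
  (forall i j, B i j = B j i) -> (forall i, \sum_j B i j = r) ->
  \sum_u \sum_v B u v * (y u - y v) ^+ 2 =
  2 * r * (\sum_i y i ^+ 2) - 2 * qform B y.
Proof.
move=> Bsym Br.
transitivity (\sum_u (r * y u ^+ 2 - 2 * (y u * mulv B y u))
              + \sum_u \sum_v B u v * y v ^+ 2).
  rewrite -big_split; apply: eq_bigr => u _ /=.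
  rewrite -(Br u) mulr_suml /mulv !mulr_sumr -!sumrB -big_split /=.
  by apply: eq_bigr => v _; ring.
have -> : \sum_u \sum_v B u v * y v ^+ 2 = r * \sum_i y i ^+ 2.
  rewrite exchange_big /= mulr_sumr; apply: eq_bigr => v _.
  by rewrite -mulr_suml -(Br v); congr (_ * _); apply: eq_bigr.
by rewrite sumrB -!mulr_sumr /qform; ring.
Qed.

Lemma sum_pairs_weighted_sqr (s g : 'I_n -> R) :
  \sum_u \sum_v s u * s v * (g u - g v) ^+ 2 =
  2 * (\sum_i s i) * (\sum_i s i * g i ^+ 2) - 2 * (\sum_i s i * g i) ^+ 2.
Proof.
set X := \sum_i s i * g i ^+ 2; set Y := \sum_i s i * g i.
transitivity (\sum_u (s u * g u ^+ 2 * (\sum_i s i) + s u * X - 2 * (s u * g u) * Y)).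
  apply: eq_bigr => u _; rewrite !mulr_sumr -big_split -sumrB /=.
  by apply: eq_bigr => v _; ring.
by rewrite sumrB big_split /= -!mulr_suml -mulr_sumr -/X -/Y; ring.
Qed.

(** On vectors of sum zero, a form with constant row sums and constant diagonal
    is an eigenfunction, up to a constant, of the sum of all swaps, with
    eigenvalue 4(n - 1) over ordered pairs.  This is the level two eigenspace of
    the Johnson scheme; the level one part is absent because row sums are
    constant. *)
Lemma sum_swaps_qform B y (r b : R) : (forall i j, B i j = B j i) ->
  (forall i, \sum_j B i j = r) -> (forall i, B i i = b) ->
  \sum_i y i = 0 ->
  \sum_u \sum_v (2 * (y u - y v) * (mulv B y u - mulv B y v)
    - (y u - y v) ^+ 2 * (B u u + B v v - 2 * B u v)) =
  4 * (n%:R - 1) * qform B y + 4 * (r - b * n%:R) * \sum_i y i ^+ 2.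
Proof.
move=> Bsym Br Bb y0.
transitivity (2 * (\sum_u \sum_v (y u - y v) * (mulv B y u - mulv B y v))
   - 2 * b * (\sum_u \sum_v (y u - y v) * (y u - y v))
   + 2 * (\sum_u \sum_v B u v * (y u - y v) ^+ 2)).
  rewrite !mulr_sumr -sumrB -big_split; apply: eq_bigr => u _ /=.
  rewrite !mulr_sumr -sumrB -big_split; apply: eq_bigr => v _ /=.
  by rewrite !Bb; ring.
rewrite !sum_pairs_subM (sum_pairs_sqr_sub _ Bsym Br) y0 -/(qform B y).
have -> : \sum_i y i * y i = \sum_i y i ^+ 2.
  by apply: eq_bigr => i _; rewrite expr2.
by ring.
Qed.

End QuadraticForms.

Section RegularGraphs.
Context {R : realType} {n d : nat} {e : rel 'I_n}.
Hypothesis e_reg : regular_graph d e.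
Implicit Types (y : 'I_n -> R).

Definition adj (i j : 'I_n) : R := (e i j)%:R.
(** The square of the adjacency matrix: the form of |A y|^2
    (see [qform_adj2]). *)
Definition adj2 (i j : 'I_n) : R := \sum_k adj i k * adj k j.

Lemma adj_sym i j : adj i j = adj j i.
Proof. by case: e_reg => es _ _; rewrite /adj es. Qed.

Lemma adj_diag i : adj i i = 0.
Proof. by case: e_reg => _ ei _; rewrite /adj ei. Qed.

Lemma adj_ge0 i j : 0 <= adj i j.
Proof. exact: ler0n. Qed.

Lemma adj_le1 i j : adj i j <= 1.
Proof. by rewrite /adj; case: (e i j). Qed.

Lemma adj_row i : \sum_j adj i j = d%:R.
Proof.
case: e_reg => _ _ /(_ i) <-; rewrite /adj -natr_sum; congr _%:R.
rewrite -sum1_card [RHS]big_mkcond /=; apply: eq_bigr => j _.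
by rewrite inE; case: (e i j).
Qed.

Lemma adj2_sym i j : adj2 i j = adj2 j i.
Proof.
apply: eq_bigr => k _; by rewrite mulrC (adj_sym k j) (adj_sym i k).
Qed.

Lemma adj2_diag i : adj2 i i = d%:R.
Proof.
rewrite -(adj_row i); apply: eq_bigr => k _.
by rewrite (adj_sym k) /adj; case: (e i k); rewrite /= ?mulr1 ?mulr0.
Qed.

Lemma adj2_ge0 i j : 0 <= adj2 i j.
Proof. by apply: sumr_ge0 => k _; rewrite mulr_ge0 // adj_ge0. Qed.

Lemma adj2_le i j : adj2 i j <= d%:R.
Proof.
rewrite -(adj_row i); apply: ler_sum => k _.
by rewrite ler_piMr ?adj_ge0 ?adj_le1.
Qed.

Lemma mulv_adj2 y i : mulv adj2 y i = mulv adj (mulv adj y) i.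
Proof.
rewrite /mulv /adj2; under eq_bigr do rewrite mulr_suml.
rewrite exchange_big; apply: eq_bigr => k _ /=.
by rewrite mulr_sumr; apply: eq_bigr => j _; rewrite mulrA.
Qed.

Lemma sum_mulv_adj y : \sum_i mulv adj y i = d%:R * \sum_i y i.
Proof.
rewrite /mulv exchange_big /= mulr_sumr; apply: eq_bigr => j _.
rewrite -mulr_suml -(adj_row j); congr (_ * _).
by apply: eq_bigr => i _; rewrite adj_sym.
Qed.

Lemma adj2_row i : \sum_j adj2 i j = d%:R ^+ 2.
Proof.
have := mulv_adj2 (fun=> 1) i; rewrite /mulv.
under eq_bigr do rewrite mulr1.
move=> ->; under eq_bigr => j _.
  rewrite (_ : \sum_j0 _ = d%:R); last by under eq_bigr do rewrite mulr1; rewrite adj_row.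
  over.
by rewrite -mulr_suml adj_row.
Qed.

Lemma qform_adj2 y : qform adj2 y = \sum_i mulv adj y i ^+ 2.
Proof.
rewrite /qform; under eq_bigr do rewrite mulv_adj2 [mulv _ _ _]/mulv mulr_sumr.
rewrite exchange_big; apply: eq_bigr => k _ /=.
rewrite expr2 [X in X * _]/mulv mulr_suml; apply: eq_bigr => i _.
by rewrite (adj_sym k); ring.
Qed.

Lemma adj_norm_le y i c : (forall j, `|y j| <= c) -> `|mulv adj y i| <= d%:R * c.
Proof.
move=> yc; rewrite (le_trans (ler_norm_sum _ _ _)) // -(adj_row i) mulr_suml.
by apply: ler_sum => j _; rewrite normrM (ger0_norm (adj_ge0 _ _)) ler_wpM2l ?adj_ge0.
Qed.

(** The operator norm of the adjacency matrix is at most d; this is the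
    Cauchy-Schwarz inequality in each row. *)
Lemma sum_sqr_mulv_adj y :
  \sum_i mulv adj y i ^+ 2 <= d%:R ^+ 2 * \sum_i y i ^+ 2.
Proof.
have h u : mulv adj y u ^+ 2 <= d%:R * \sum_j adj u j * y j ^+ 2.
  rewrite -subr_ge0.
  have hs : 0 <= \sum_j adj u j * (d%:R * y j - mulv adj y u) ^+ 2.
    by apply: sumr_ge0 => j _; rewrite mulr_ge0 ?adj_ge0 ?sqr_ge0.
  have E : \sum_j adj u j * (d%:R * y j - mulv adj y u) ^+ 2 =
      d%:R * (d%:R * (\sum_j adj u j * y j ^+ 2) - mulv adj y u ^+ 2).
    (* Stated for a variable m, so that [mulr_sumr] does not unfold [mulv]. *)
  have expand m : \sum_j adj u j * (d%:R * y j - m) ^+ 2 =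
        d%:R ^+ 2 * (\sum_j adj u j * y j ^+ 2)
        - 2 * d%:R * m * (\sum_j adj u j * y j) + m ^+ 2 * \sum_j adj u j.
      by rewrite !mulr_sumr -sumrB -big_split; apply: eq_bigr => j _ /=; ring.
    by rewrite expand adj_row -/(mulv adj y u); ring.
  rewrite E in hs; have [d0|d0] := posnP d.
    have a0 j : adj u j = 0.
      apply/eqP; have /eqP := adj_row u; rewrite d0 psumr_eq0 => [|j' _]; last exact: adj_ge0.
      by move/allP/(_ j); rewrite mem_index_enum; apply.
    rewrite d0 mul0r sub0r oppr_ge0 /mulv big1 ?expr0n //= => j _.
    by rewrite a0 mul0r.
  by rewrite pmulr_rge0 ?ltr0n in hs.
apply: (le_trans (y := \sum_u d%:R * \sum_j adj u j * y j ^+ 2)).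
  by apply: ler_sum => u _; exact: h.
rewrite -mulr_sumr exchange_big /= expr2 -mulrA ler_wpM2l // mulr_sumr.
rewrite le_eqVlt; apply/orP; left; apply/eqP; apply: eq_bigr => j _.
rewrite -mulr_suml -(adj_row j); congr (_ * _).
by apply: eq_bigr => i _; rewrite adj_sym.
Qed.

Lemma degree_le : (0 < n)%N -> (d <= n)%N.
Proof.
move=> n0; case: e_reg => _ _ /(_ (Ordinal n0)) <-.
by rewrite -[X in (_ <= X)%N]card_ord max_card.
Qed.

End RegularGraphs.

(** * Gibbs laws, product overlap and single spin flips *)

Section Gibbs.
Context {R : realType} {n : nat}.
Implicit Types (H : config n -> R).

Lemma gibbs_norm_gt0 H : 0 < \sum_(y : config n) expR (H y).
Proof.
rewrite (bigD1 [ffun=> true]) //= ltr_pwDl ?expR_gt0 //.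
by apply: sumr_ge0 => *; exact: expR_ge0.
Qed.

Lemma gibbsE H x : gibbs H x = expR (H x - ln (\sum_(y : config n) expR (H y))).
Proof. by rewrite /gibbs expRD expRN lnK // posrE gibbs_norm_gt0. Qed.

Lemma gibbs_gt0 H x : 0 < gibbs H x.
Proof. by rewrite gibbsE expR_gt0. Qed.

Lemma sum_gibbs H : \sum_x gibbs H x = 1.
Proof. by rewrite /gibbs -mulr_suml divff // gt_eqF // gibbs_norm_gt0. Qed.

Lemma sum_gibbs_mul H (f : config n -> R) :
  \sum_x gibbs H x * f x =
  (\sum_x expR (H x) * f x) / \sum_(y : config n) expR (H y).
Proof. by rewrite mulr_suml; apply: eq_bigr => x _; rewrite mulrAC. Qed.

(** The log-densities differ from H0 and H1 by the constants log Z, which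
    disappear when integrated against a difference of probabilities. *)
Lemma gibbs_triangular_le H0 H1 :
  \sum_x (gibbs H1 x - gibbs H0 x) ^+ 2 / (gibbs H0 x + gibbs H1 x) <=
  \sum_x (gibbs H1 x - gibbs H0 x) * (H1 x - H0 x).
Proof.
set c0 := ln (\sum_(y : config n) expR (H0 y)).
set c1 := ln (\sum_(y : config n) expR (H1 y)).
have -> : \sum_x (gibbs H1 x - gibbs H0 x) * (H1 x - H0 x) =
   \sum_x (gibbs H1 x - gibbs H0 x) * ((H1 x - c1) - (H0 x - c0)).
  have e0 : \sum_x (gibbs H1 x - gibbs H0 x) * (c1 - c0) = 0.
    by rewrite -mulr_suml sumrB !sum_gibbs subrr mul0r.
  apply/eqP; rewrite -subr_eq0 -sumrB -[X in _ == X]e0; apply/eqP.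
  by apply: eq_bigr => x _ /=; ring.
by apply: ler_sum => x _; rewrite !gibbsE expR_monotone_sub_ge.
Qed.

(** By Cauchy-Schwarz the square of the L1 distance is at most twice the
    triangular discrimination, and the overlap is one minus half that
    distance. *)
Lemma gibbs_overlap_ge H0 H1 (s : R) : 0 < s ->
  \sum_x (gibbs H1 x - gibbs H0 x) * (H1 x - H0 x) <= 8 * s ^+ 2 ->
  1 - 2 * s <= \sum_x Num.min (gibbs H0 x) (gibbs H1 x).
Proof.
move=> s0 hJ; have hT := le_trans (gibbs_triangular_le H0 H1) hJ.
have hV : \sum_x `|gibbs H0 x - gibbs H1 x| <= 4 * s.
  apply: (le_trans (y := \sum_x (s * (gibbs H0 x + gibbs H1 x) +
     (4 * s)^-1 * ((gibbs H1 x - gibbs H0 x) ^+ 2 / (gibbs H0 x + gibbs H1 x))))).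
    apply: ler_sum => x _; rewrite distrC.
    have p0 : 0 < gibbs H0 x + gibbs H1 x by rewrite addr_gt0 ?gibbs_gt0.
    set p := gibbs H0 x + gibbs H1 x in p0 *; set a := gibbs H1 x - gibbs H0 x.
    rewrite -(real_normK (num_real a)) -subr_ge0.
    have -> : s * p + (4 * s)^-1 * (`|a| ^+ 2 / p) - `|a| =
       (2 * s * p - `|a|) ^+ 2 / (4 * s * p).
      by field; rewrite !gt_eqF.
    by rewrite mulr_ge0 ?sqr_ge0 // invr_ge0 !mulr_ge0 // ltW.
  rewrite big_split /= -!mulr_sumr big_split /= !sum_gibbs.
  have : (4 * s)^-1 * \sum_x (gibbs H1 x - gibbs H0 x) ^+ 2 / (gibbs H0 x + gibbs H1 x)
     <= (4 * s)^-1 * (8 * s ^+ 2).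
    by rewrite ler_wpM2l // invr_ge0 mulr_ge0 // ltW.
  have -> : (4 * s)^-1 * (8 * s ^+ 2) = 2 * s by field; rewrite gt_eqF.
  lra.
under eq_bigr do rewrite minr_absE.
rewrite -mulr_suml sumrB big_split /= !sum_gibbs; lra.
Qed.

End Gibbs.

Section ProductOverlap.
Context {R : realType} {n : nat}.
Implicit Types (p q f : config n -> R).

Lemma sum_tuple_prod k f :
  \sum_(s : k.-tuple (config n)) \prod_(i < k) f (tnth s i) = (\sum_x f x) ^+ k.
Proof.
have -> : (\sum_x f x) ^+ k = \prod_(i < k) \sum_x f x.
  by rewrite prodr_const card_ord.
rewrite bigA_distr_bigA /=.
rewrite (reindex (fun g : {ffun 'I_k -> config n} => [tuple g i | i < k])) /=.
  by apply: eq_bigr => g _; apply: eq_bigr => i _; rewrite tnth_mktuple.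
exists (fun s : k.-tuple (config n) => [ffun i => tnth s i]) => [g _|s _].
  by apply/ffunP => i; rewrite ffunE tnth_mktuple.
by apply: eq_from_tnth => i; rewrite tnth_mktuple ffunE.
Qed.

Lemma Pr_iid_ge0 k p (E : pred (k.-tuple (config n))) :
  (forall x, 0 <= p x) -> 0 <= Pr_iid p E.
Proof. by move=> p0; apply: sumr_ge0 => s _; apply: prodr_ge0. Qed.

Lemma Pr_iid_le1 k p (E : pred (k.-tuple (config n))) :
  (forall x, 0 <= p x) -> \sum_x p x = 1 -> Pr_iid p E <= 1.
Proof.
move=> p0 p1; rewrite -(expr1n _ k) -p1 -sum_tuple_prod /Pr_iid big_mkcond /=.
by apply: ler_sum => s _; case: (E s) => //; apply: prodr_ge0.
Qed.

(** A product of minima is below the minimum of the products, so the overlap of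
    the k-fold laws is at least the k-th power of the overlap. *)
Lemma errors_ge_overlap k p q (t : decision n k) :
  (forall x, 0 <= p x) -> (forall x, 0 <= q x) ->
  (\sum_x Num.min (p x) (q x)) ^+ k <=
  Pr_iid p (fun s => t s) + Pr_iid q (fun s => ~~ t s).
Proof.
move=> p0 q0; rewrite -sum_tuple_prod (bigID (fun s => t s)) /=.
by apply: lerD; apply: ler_sum => s _; apply: ler_prod => i _;
  rewrite ge_min lexx ?orbT le_min p0 q0.
Qed.

End ProductOverlap.

Section SpinForms.
Context {R : realType} {n d : nat} {e : rel 'I_n}.
Hypothesis e_reg : regular_graph d e.
Let A : 'I_n -> 'I_n -> R := @adj R n e.
Let A2 : 'I_n -> 'I_n -> R := @adj2 R n e.

Definition spin_at (x : config n) (i : 'I_n) : R := spin (x i).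

Lemma spin_at_sqr x i : spin_at x i ^+ 2 = 1.
Proof. by rewrite /spin_at /spin; case: (x i); rewrite ?sqrrN expr1n. Qed.

Lemma spin_at_norm x i : `|spin_at x i| = 1.
Proof. by rewrite /spin_at /spin; case: (x i); rewrite ?normrN normr1. Qed.

Lemma kappa_IsingE x : kappa_Ising e x = qform A (spin_at x).
Proof.
rewrite /kappa_Ising -mulmxA mxE; apply: eq_bigr => i _; rewrite !mxE.
by congr (_ * _); apply: eq_bigr => j _; rewrite !mxE.
Qed.

Definition flip (u : 'I_n) (x : config n) : config n := [ffun i => (i == u) (+) x i].

Lemma flipK u : involutive (flip u).
Proof. by move=> x; apply/ffunP => i; rewrite !ffunE; case: (i == u); case: (x i). Qed.

Lemma spin_at_flip u x i : spin_at (flip u x) i = if i == u then - spin_at x i else spin_at x i.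
Proof.
by rewrite /spin_at /spin ffunE; case: (i == u); case: (x i); rewrite //= opprK.
Qed.

Let k (x : config n) : R := kappa_Ising e x.
Let F (x : config n) : R := qform A2 (spin_at x).

Lemma jump_flip_kappa u x : jump flip k u x = 4 * spin_at x u * mulv A (spin_at x) u.
Proof.
rewrite /jump /k !kappa_IsingE (qform_flipB (adj_sym e_reg) (spin_at_flip u x)).
by rewrite (adj_diag e_reg) mulr0 subr0.
Qed.

Lemma sum_jump_flip_kappa x : \sum_u jump flip k u x = 4 * k x.
Proof.
rewrite /k kappa_IsingE /qform mulr_sumr; apply: eq_bigr => u _.
by rewrite jump_flip_kappa mulrA.
Qed.

Lemma sum_jump_flip_kappa_sqr x : \sum_u jump flip k u x ^+ 2 = 16 * F x.
Proof.
rewrite /F (qform_adj2 e_reg) mulr_sumr; apply: eq_bigr => u _.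
by rewrite jump_flip_kappa !exprMn spin_at_sqr mulr1 -natrX.
Qed.

Lemma jump_flip_energy u x :
  jump flip F u x = 4 * spin_at x u * mulv A2 (spin_at x) u - 4 * d%:R.
Proof.
rewrite /jump /F (qform_flipB (adj2_sym e_reg) (spin_at_flip u x)).
by rewrite (adj2_diag e_reg) spin_at_sqr mulr1.
Qed.

Lemma sum_jump_flip_energy x : \sum_u jump flip F u x = 4 * F x - 4 * n%:R * d%:R.
Proof.
under eq_bigr do rewrite jump_flip_energy.
rewrite sumrB sumr_const card_ord /F /qform mulr_sumr -[X in _ - X]mulr_natl.
by congr (_ - _); [apply: eq_bigr => i _|]; ring.
Qed.

Lemma sum_jump_flip_energy_sqr x :
  \sum_u jump flip F u x ^+ 2 <= 32 * d%:R ^+ 2 * F x + 32 * n%:R * d%:R ^+ 2.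
Proof.
have h u : jump flip F u x ^+ 2 <= 32 * mulv A (mulv A (spin_at x)) u ^+ 2 + 32 * d%:R ^+ 2.
  rewrite jump_flip_energy mulv_adj2; set a := mulv A _ u; set b : R := d%:R.
  have s1 := spin_at_sqr x u; set s := spin_at x u in s1 *.
  have -> : 32 * a ^+ 2 + 32 * b ^+ 2 =
     (4 * s * a - 4 * b) ^+ 2 + (4 * s * a + 4 * b) ^+ 2 + 32 * a ^+ 2 * (1 - s ^+ 2).
    ring.
  by rewrite s1 subrr mulr0 addr0 lerDl sqr_ge0.
apply: (le_trans (ler_sum _ (fun u _ => h u))).
rewrite big_split /= -mulr_sumr sumr_const card_ord.
have := sum_sqr_mulv_adj e_reg (mulv A (spin_at x)).
rewrite -[X in _ <= _ * X](qform_adj2 e_reg) -/(F x) -[X in _ + X]mulr_natl => h2.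
by nra.
Qed.

Let in_setT_flip u x : (flip u x \in [set: config n]%SET) = (x \in [set: config n]%SET).
Proof. by rewrite !inE. Qed.

Lemma sum_kappa_eq0 : \sum_x k x = 0.
Proof.
have := sum_jump_symmetrize flipK in_setT_flip (fun=> 1) k.
under eq_bigr do rewrite mul1r sum_jump_flip_kappa.
under [in RHS]eq_bigr do under eq_bigr do rewrite /jump subrr mul0r.
under [in RHS]eq_bigr do rewrite big1 //.
rewrite [in RHS]big1 // mulr0 -mulr_sumr => /eqP.
by rewrite mulf_eq0 pnatr_eq0 /= => /eqP; under eq_bigl do rewrite inE.
Qed.

Variable t : R.
Hypotheses (t_ge0 : 0 <= t) (td_le : t * d%:R <= 16^-1) (d_gt0 : (0 < d)%N).
Let w x := expR (t * k x).

Let small u x : x \in [set: config n]%SET -> `|t * jump flip k u x| <= 2^-1.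
Proof.
move=> _; rewrite jump_flip_kappa !normrM spin_at_norm (ger0_norm t_ge0) mulr1 ger0_norm //.
have h : `|mulv A (spin_at x) u| <= d%:R.
  by rewrite -[leRHS]mulr1; apply: (adj_norm_le e_reg) => j; rewrite spin_at_norm.
have h2 : t * `|mulv A (spin_at x) u| <= t * d%:R by rewrite ler_wpM2l.
by have h3 := td_le; rewrite mulrCA; lra.
Qed.

(** The energy |A x|^2 has mean nd at t = 0.  Under the tilt the identity for
    its jumps bounds the excess by a multiple of td times the energy plus n; the
    energy is absorbed on the left because td <= 1/16. *)
Lemma tilted_flip_energy_le :
  \sum_x w x * F x <= 2 * n%:R * d%:R * \sum_x w x.
Proof.
have d0 : 0 < d%:R :> R by rewrite ltr0n.
have := tilted_sum_jump_le flipK in_setT_flip t_ge0 small F d0.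
under eq_bigl do rewrite inE.
under [in leRHS]eq_bigl do rewrite inE.
under eq_bigr do rewrite sum_jump_flip_energy.
move=> /(le_trans (ler_norm _)); rewrite -/w => h.
set Z := \sum_x w x; set EF := \sum_x w x * F x.
have e1 : \sum_x w x * (4 * F x - 4 * n%:R * d%:R) = 4 * EF - 4 * n%:R * d%:R * Z.
  by rewrite !mulr_sumr -sumrB; apply: eq_bigr => x _; ring.
have e2 : \sum_x w x * (d%:R^-1 * (\sum_u jump flip F u x ^+ 2)
                         + d%:R * \sum_u jump flip k u x ^+ 2) <=
   d%:R * (48 * EF + 32 * n%:R * Z).
  rewrite !mulr_sumr -big_split /= mulr_sumr; apply: ler_sum => x _.
  rewrite sum_jump_flip_kappa_sqr.
  have h2 := sum_jump_flip_energy_sqr x.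
  have h3 : d%:R^-1 * (\sum_u jump flip F u x ^+ 2) <=
     d%:R * (32 * F x + 32 * n%:R).
    rewrite ler_pdivrMl // (le_trans h2) // le_eqVlt; apply/orP; left.
    by apply/eqP; ring.
  rewrite (_ : d%:R * (48 * (w x * F x) + 32 * n%:R * w x) =
     w x * (d%:R * (32 * F x + 32 * n%:R) + d%:R * (16 * F x))); last by ring.
  by rewrite ler_wpM2l ?expR_ge0 // lerD2r.
rewrite e1 in h.
have h4 : 4 * EF - 4 * n%:R * d%:R * Z <= t / 2 * (d%:R * (48 * EF + 32 * n%:R * Z)).
  by apply: (le_trans h); rewrite ler_wpM2l // divr_ge0.
have Z0 : 0 <= Z by apply: sumr_ge0 => x _; exact: expR_ge0.
have EF0 : 0 <= EF.
  apply: sumr_ge0 => x _; rewrite mulr_ge0 ?expR_ge0 // /F (qform_adj2 e_reg).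
  by apply: sumr_ge0 => i _; exact: sqr_ge0.
have nZ : 0 <= n%:R * Z by rewrite mulr_ge0.
have nZd : n%:R * Z <= n%:R * d%:R * Z.
  by rewrite mulrAC ler_peMr // ler1n.
have -> : 2 * n%:R * d%:R * Z = 2 * (n%:R * d%:R * Z) by ring.
have h5 : t / 2 * (d%:R * (48 * EF + 32 * n%:R * Z)) <= 16^-1 / 2 * (48 * EF + 32 * (n%:R * Z)).
  rewrite (_ : t / 2 * _ = t * d%:R * (2^-1 * (48 * EF + 32 * (n%:R * Z)))); last by ring.
  rewrite -[leRHS]mulrA ler_wpM2r //; nra.
nra.
Qed.

(** The squared jumps of kappa add up to 16 |A x|^2, so the mean of kappa under
    the tilt is at most a multiple of t times the mean energy. *)
Lemma tilted_flip_kappa_le :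
  \sum_x w x * k x <= 8 * t * n%:R * d%:R * \sum_x w x.
Proof.
have := tilted_sum_jump_le flipK in_setT_flip t_ge0 small k ltr01.
under eq_bigl do rewrite inE.
under [in leRHS]eq_bigl do rewrite inE.
under eq_bigr do rewrite sum_jump_flip_kappa.
under [in leRHS]eq_bigr do rewrite invr1 !mul1r sum_jump_flip_kappa_sqr.
move=> /(le_trans (ler_norm _)); rewrite -/w => h.
have hF := tilted_flip_energy_le.
have e1 : \sum_x w x * (4 * k x) = 4 * \sum_x w x * k x.
  by rewrite mulr_sumr; apply: eq_bigr => x _; ring.
have e2 : \sum_x w x * (16 * F x + 16 * F x) = 32 * \sum_x w x * F x.
  by rewrite mulr_sumr; apply: eq_bigr => x _; ring.
rewrite e1 e2 in h.
have : t / 2 * (32 * \sum_x w x * F x) <= t / 2 * (32 * (2 * n%:R * d%:R * \sum_x w x)).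
  by rewrite ler_wpM2l ?divr_ge0 // ler_wpM2l.
nra.
Qed.

End SpinForms.

(** * Undetectability at weak coupling *)

Section LimitsAlong.
Context {R : realType} (I : set nat).

Lemma near_within_ooP (P : nat -> Prop) :
  (\forall n \near within I \oo, P n) <->
  exists N, forall n, (N <= n)%N -> I n -> P n.
Proof.
rewrite near_withinE; split.
  by case=> N _ h; exists N => n Nn; exact: (h n Nn).
by case=> N h; exists N => // n; exact: h.
Qed.

Lemma infinite_set_unbounded (N : nat) : infinite_set I ->
  exists2 n, (N <= n)%N & I n.
Proof.
move=> Iinf; apply: contrapT => h; apply: Iinf.
apply: (sub_finite_set _ (finite_II N)) => n In /=.
by rewrite ltnNge; apply/negP => Nn; apply: h; exists n.
Qed.

End LimitsAlong.

Section Risk.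
Context {R : realType} {n k : nat}.
Variables (p q : R * R -> config n -> R).
Hypotheses (p_ge0 : forall th x, 0 <= p th x) (q_ge0 : forall th x, 0 <= q th x).
Hypotheses (p_sum : forall th, \sum_x p th x = 1) (q_sum : forall th, \sum_x q th x = 1).
Variables (Lambda0 Lambda1 : set (R * R)) (t : decision n k).

Lemma max_errors_le1 th0 th1 :
  Num.max (Pr_iid (p th0) (fun s => t s)) (Pr_iid (q th1) (fun s => ~~ t s)) <= 1.
Proof. by rewrite ge_max !Pr_iid_le1. Qed.

Lemma max_errors_le_risk th0 th1 : Lambda0 th0 -> Lambda1 th1 ->
  Num.max (Pr_iid (p th0) (fun s => t s)) (Pr_iid (q th1) (fun s => ~~ t s))
  <= risk p q Lambda0 Lambda1 t.
Proof.
move=> h0 h1; apply: ub_le_sup; last by exists th0 => //; exists th1.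
exists 1 => _ [a _ [b _ <-]]; exact: max_errors_le1.
Qed.

Lemma risk_ge0 th0 th1 : Lambda0 th0 -> Lambda1 th1 -> 0 <= risk p q Lambda0 Lambda1 t.
Proof.
move=> h0 h1; apply: le_trans (max_errors_le_risk h0 h1).
by rewrite le_max Pr_iid_ge0.
Qed.

Lemma risk_le c th0 th1 : Lambda0 th0 -> Lambda1 th1 ->
  (forall th, Lambda0 th -> Pr_iid (p th) (fun s => t s) <= c) ->
  (forall th, Lambda1 th -> Pr_iid (q th) (fun s => ~~ t s) <= c) ->
  risk p q Lambda0 Lambda1 t <= c.
Proof.
move=> h0 h1 hp hq; apply: ge_sup.
  by eexists; exists th0 => //; exists th1.
by move=> _ [a /hp ha [b /hq hb <-]]; rewrite ge_max ha hb.
Qed.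

End Risk.

Section WeakCoupling.
Context {R : realType}.

(** With t = beta / 2 and s = t sqrt(nd) = 1 / (2L), the symmetrized relative
    entropy is t E_q kappa <= 8 s^2, since kappa has mean zero under the uniform law. *)
Lemma overlap_uniform_ising n d (e : rel 'I_n) (l : R) :
  (0 < n)%N -> (0 < d)%N -> regular_graph d e -> 8 <= l ->
  1 - l^-1 <=
  \sum_x Num.min (@curie_weiss R n (0, 0) x)
                 (ising e (1 / (l * Num.sqrt (n * d)%:R), 0) x).
Proof.
move=> n0 d0 e_reg l8.
have l0 : 0 < l by apply: lt_le_trans l8.
set D := Num.sqrt (n * d)%:R; set beta := 1 / _.
have D0 : 0 < D by rewrite sqrtr_gt0 ltr0n muln_gt0 n0.
have DD : D ^+ 2 = n%:R * d%:R by rewrite sqr_sqrtr ?ler0n // natrM.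
have b0 : 0 < beta by rewrite divr_gt0 ?mulr_gt0.
have dD : d%:R <= D.
  rewrite -(ler_pXn2r (n := 2)) ?nnegrE ?ler0n ?(ltW D0) // DD expr2.
  by rewrite ler_wpM2r ?ler_nat // (degree_le e_reg).
set H1 := fun x : config n => (beta, 0 : R).1 / 2 * kappa_Ising e x
  + n%:R * (beta, 0 : R).2 * magn x.
set H0 := fun x : config n => n%:R / 2 * ((0 : R), (0 : R)).1 * magn x ^+ 2
  + n%:R * ((0 : R), (0 : R)).2 * magn x.
have E0 x : H0 x = 0 by rewrite /H0 /= !(mulr0, mul0r) addr0.
have E1 x : H1 x = beta / 2 * kappa_Ising e x by rewrite /H1 /= mulr0 mul0r addr0.
rewrite /curie_weiss /ising -/H0 -/H1.
have -> : 1 - l^-1 = 1 - 2 * (beta / 2 * D).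
  by rewrite /beta; field; rewrite !gt_eqF.
have s0 : 0 < beta / 2 * D by rewrite mulr_gt0 // divr_gt0.
apply: gibbs_overlap_ge => //.
have U x : gibbs H0 x = (\sum_(y : config n) 1)^-1.
  rewrite /gibbs E0 expR0 div1r; congr (_^-1).
  by apply: eq_bigr => y _; rewrite E0 expR0.
have -> : \sum_x (gibbs H1 x - gibbs H0 x) * (H1 x - H0 x) =
    beta / 2 * \sum_x gibbs H1 x * kappa_Ising e x.
  transitivity (beta / 2 * (\sum_x gibbs H1 x * kappa_Ising e x
    - (\sum_(y : config n) 1)^-1 * \sum_x kappa_Ising e x)).
    rewrite mulr_sumr -sumrB mulr_sumr; apply: eq_bigr => x _.
    by rewrite U E0 E1; ring.
  by rewrite (sum_kappa_eq0 e_reg) mulr0 subr0.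
rewrite sum_gibbs_mul.
have -> : 8 * (beta / 2 * D) ^+ 2 = beta / 2 * (8 * (beta / 2) * n%:R * d%:R).
  by rewrite exprMn DD; ring.
rewrite ler_wpM2l //; first by rewrite ltW // divr_gt0.
rewrite ler_pdivrMr ?gibbs_norm_gt0 //.
under eq_bigr do rewrite E1.
under [in leRHS]eq_bigr do rewrite E1.
apply: (tilted_flip_kappa_le e_reg) => //; first by rewrite ltW // divr_gt0.
have -> : beta / 2 * d%:R = d%:R / D / (2 * l).
  by rewrite /beta; field; rewrite !gt_eqF.
rewrite ler_pdivrMr ?mulr_gt0 // (le_trans (y := 1)) //.
  by rewrite ler_pdivrMr // mul1r.
lra.
Qed.

Lemma weak_coupling_undetectable (bmax hmax : R) (I : set nat) (d : nat -> nat)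
    (L : nat -> R) (G : forall n, rel 'I_n) k (t : forall n, decision n k) :
  0 <= bmax -> 0 <= hmax -> infinite_set I ->
  (forall n, I n -> (0 < d n)%N) -> positive_divergent I L ->
  (forall n, I n -> regular_graph (d n) (G n)) ->
  ~ distinguishes I (fun n => @curie_weiss R n) (fun n => ising (G n))
       (fun _ => Lambda_CW bmax hmax)
       (fun n => Lambda_weak hmax n (d n) (L n)) t.
Proof.
move=> b0 h0 Iinf d0 [_ Loo] Greg /cvgrPdist_lt /(_ (2^-1 ^+ k.+1)) [].
  by rewrite exprn_gt0 // invr_gt0.
move=> N1 _ hN1.
move/cvgryPge : Loo => /(_ 8) /near_within_ooP [N2 hN2].
have [n] := infinite_set_unbounded (maxn 1 (maxn N1 N2)) Iinf.
rewrite !geq_max => /and3P[n0 n1 n2] In.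
have := hN1 n n1 In; rewrite sub0r normrN /=; apply/negP; rewrite -leNgt.
apply: le_trans (ler_norm _).
set th1 : R * R := (1 / (L n * Num.sqrt (n * d n)%:R), 0).
have w0 : Lambda_CW bmax hmax (0, 0) by split; rewrite /= ?lexx ?normr0.
have w1 : Lambda_weak hmax n (d n) (L n) th1 by split; rewrite /= ?normr0.
apply: le_trans (max_errors_le_risk _ _ _ _ (t n) w0 w1).
- have ov := overlap_uniform_ising n0 (d0 _ In) (Greg _ In) (hN2 _ n2 In).
  have := errors_ge_overlap (p := @curie_weiss R n (0, 0)) (q := ising (G n) th1) (t n).
  move=> /(_ (fun x => ltW (gibbs_gt0 _ x)) (fun x => ltW (gibbs_gt0 _ x))).
  have half : 2^-1 <= 1 - (L n)^-1.
    have L8 := hN2 _ n2 In.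
    have : (L n)^-1 <= 8^-1 by rewrite lef_pV2 ?posrE // (lt_le_trans _ L8).
    lra.
  have := lerXn2r k _ _ (le_trans half ov); rewrite !nnegrE => /(_ _ _).
  move=> /(_ _ _)/le_trans hk /hk{hk}.
  set a := Pr_iid _ _; set b := Pr_iid _ _; rewrite exprS => h.
  have : Num.max a b >= a by rewrite le_max lexx.
  have : Num.max a b >= b by rewrite le_max lexx orbT.
  lra.
- by move=> th x; exact: ltW (gibbs_gt0 _ _).
- by move=> th x; exact: ltW (gibbs_gt0 _ _).
- by move=> th; exact: sum_gibbs.
- by move=> th; exact: sum_gibbs.
Qed.

End WeakCoupling.

(** * The magnetization under the Curie-Weiss law *)

Section SpinCounts.
Context {R : realType} {n : nat}.

Definition count_spin (b : bool) (x : config n) : nat := \sum_(i < n) (x i == b).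

Lemma count_spin_flip b u (x : config n) : x u != b ->
  count_spin b (flip u x) = (count_spin b x).+1.
Proof.
move=> xu; rewrite /count_spin (bigD1 u) //= [in RHS](bigD1 u) //= -addSn.
congr (_ + _)%N; last first.
  by apply: eq_bigr => i iu; rewrite ffunE (negPf iu).
by rewrite ffunE eqxx; case: (x u) xu; case: b.
Qed.

Lemma count_spin_flip_pred b u (x : config n) : x u == b ->
  (count_spin b (flip u x)).+1 = count_spin b x.
Proof.
move=> xu; rewrite -(flipK u x) [in RHS]count_spin_flip ?flipK //.
by rewrite ffunE eqxx; case: (x u) xu; case: b.
Qed.

Lemma magn_count_spin (x : config n) : (0 < n)%N ->
  magn x = 1 - 2 * (count_spin false x)%:R / n%:R :> R /\
  magn x = -1 + 2 * (count_spin true x)%:R / n%:R :> R.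
Proof.
move=> n0; have n0' : n%:R != 0 :> R by rewrite pnatr_eq0 -lt0n.
have card : \sum_(i < n) (1 : R) = n%:R by rewrite sumr_const card_ord.
rewrite /magn /count_spin !natr_sum; split.
  have -> : \sum_(i < n) spin (x i) = \sum_(i < n) (1 - 2 * (x i == false)%:R) :> R.
    by apply: eq_bigr => i _; rewrite /spin; case: (x i) => /=; ring.
  by rewrite sumrB -mulr_sumr card; field.
have -> : \sum_(i < n) spin (x i) = \sum_(i < n) (2 * (x i == true)%:R - 1) :> R.
  by apply: eq_bigr => i _; rewrite /spin; case: (x i) => /=; ring.
by rewrite sumrB -mulr_sumr card; field.
Qed.

Variables (w : config n -> R) (c : R).
Hypotheses (w_ge0 : forall x, 0 <= w x) (c_gt0 : 0 < c) (c_le1 : c <= 1).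
Hypothesis w_flip : forall u x, c * w x <= w (flip u x).

Definition lower_tail (b : bool) (a : nat) : R := \sum_(x | (count_spin b x < a)%N) w x.

Lemma lower_tail_ge0 b a : 0 <= lower_tail b a.
Proof. by apply: sumr_ge0. Qed.

Lemma lower_tail_le_total b a : lower_tail b a <= \sum_x w x.
Proof. by rewrite /lower_tail big_mkcond; apply: ler_sum => x _; case: ifP. Qed.

(** Double counting of the pairs (x, flip i x) where the flip creates a spin b:
    a configuration with fewer than a spins b has at least n - a such flips, and
    one with at most a of them is reached at most a times. *)
Lemma lower_tail_step b a :
  (n%:R - a%:R) * c * lower_tail b a <= a%:R * lower_tail b a.+1.
Proof.
(* Exchange the sums and reindex by the flip at i. *)
have dc : \sum_(x | (count_spin b x < a)%N) \sum_(i | x i != b) w (flip i x) =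
          \sum_(x | (count_spin b x < a.+1)%N) \sum_(i | x i == b) w x.
  rewrite (exchange_big_dep predT) //= [RHS](exchange_big_dep predT) //=.
  apply: eq_bigr => i _; rewrite [LHS](reindex_inj (inv_inj (flipK i))) /=.
  apply: eq_big => [x|x _]; last by rewrite flipK.
  have -> : (flip i x i != b) = (x i == b).
    by rewrite ffunE eqxx; case: (x i); case: (b).
  have [xi|] := boolP (x i == b); last by rewrite !andbF.
  by rewrite -(count_spin_flip_pred xi).
apply: (le_trans (y := \sum_(x | (count_spin b x < a)%N) \sum_(i | x i != b) w (flip i x))).
  rewrite /lower_tail mulr_sumr; apply: ler_sum => x xa.
  apply: (le_trans (y := \sum_(i | x i != b) c * w x)); last exact: ler_sum.
  rewrite sumr_const -[leRHS]mulr_natl -mulrA.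
  apply: (@ler_wpM2r R (c * w x)).
    by rewrite mulr_ge0 // ltW.
  rewrite lerBlDr -natrD ler_nat.
  rewrite -[X in (X <= _)%N]card_ord -(cardC (fun i => x i != b)) leq_add2l.
  rewrite (leq_trans _ (ltnW xa)) // /count_spin -sum1_card big_mkcond /=.
  by apply: leq_sum => i _; rewrite inE negbK; case: eqP.
rewrite dc /lower_tail mulr_sumr; apply: ler_sum => x xa.
rewrite sumr_const -[leLHS]mulr_natl; apply: (@ler_wpM2r R (w x)) => //; rewrite ler_nat.
rewrite -ltnS (leq_trans _ xa) // ltnS /count_spin -sum1_card big_mkcond /=.
by apply: leq_sum => i _; rewrite unfold_in; case: (x i); case: (b).
Qed.

(** As long as a is below c n / (4 e), the previous step gains a factor 1/e; it
    is iterated r times and the last tail is bounded by the total mass. *)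
Lemma lower_tail_decay b a r :
  (a + r)%:R <= 1 + expR (-1) * c / 4 * n%:R -> (0 < n)%N ->
  lower_tail b a <= expR (- r%:R) * \sum_x w x.
Proof.
move=> + n0; elim: r a => [|r IH] a har.
  by rewrite oppr0 expR0 mul1r lower_tail_le_total.
have n0' : 0 < n%:R :> R by rewrite ltr0n.
have e1 : expR (-1) <= 1 :> R by rewrite expR_le1 lerN10.
have e0 := expR_gt0 (-1 : R).
have aln : a%:R <= expR (-1) * c / 4 * n%:R.
  by move: har; rewrite addnS -natr1 natrD; have := ler0n R r; lra.
set g := expR (-1) * c in aln har *.
have g0 : 0 < g by rewrite mulr_gt0.
have g1 : g <= 1 by rewrite mulr_ile1 // ltW.
have step := lower_tail_step b a.
have T0 := lower_tail_ge0 b a; have T1 := lower_tail_ge0 b a.+1.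
have key : lower_tail b a <= expR (-1) * lower_tail b a.+1.
  have na : 2^-1 * n%:R <= n%:R - a%:R :> R by nra.
  have h1 : c * n%:R / 2 * lower_tail b a <= g / 4 * n%:R * lower_tail b a.+1.
    apply: (le_trans (y := (n%:R - a%:R) * c * lower_tail b a)).
      rewrite ler_wpM2r // [leLHS](_ : _ = 2^-1 * n%:R * c); last by ring.
      by rewrite ler_wpM2r // ltW.
    by apply: (le_trans step); rewrite ler_wpM2r.
  have cn : 0 < c * n%:R / 2 by rewrite divr_gt0 ?mulr_gt0.
  rewrite -(ler_pM2l cn) (le_trans h1) //.
  rewrite [leRHS](_ : _ = g / 2 * n%:R * lower_tail b a.+1); last by rewrite /g; ring.
  by rewrite !ler_wpM2r //; lra.
apply: (le_trans key); rewrite -natr1 opprD addrC expRD -mulrA ler_pM2l //.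
by apply: IH; rewrite addSnnS.
Qed.

End SpinCounts.

Section CurieWeissBulk.
Context {R : realType}.

Lemma sum_spin n (x : config n) : (0 < n)%N -> \sum_i spin_at x i = n%:R * magn x :> R.
Proof. by move=> n0; rewrite /magn mulrA divff ?mul1r // pnatr_eq0 -lt0n. Qed.

Lemma magn_norm_le1 n (x : config n) : (0 < n)%N -> `|magn x : R| <= 1.
Proof.
move=> n0; have n0' : 0 < n%:R :> R by rewrite ltr0n.
rewrite -(ler_pM2l n0') -[X in X * _]ger0_norm // -normrM -sum_spin // mulr1.
rewrite (le_trans (ler_norm_sum _ _ _)) // -[X in _ <= X%:R](card_ord n) -sumr_const.
by apply: ler_sum => i _; rewrite spin_at_norm.
Qed.

Lemma magn_flip n u (x : config n) : magn (flip u x) = magn x - 2 * spin_at x u / n%:R :> R.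
Proof.
rewrite /magn; set a := \sum_(i < n) spin (x i).
have -> : \sum_(i < n) spin (flip u x i) = a - 2 * spin_at x u.
  rewrite -(sum_delta u (spin_at x)) mulr_sumr -sumrB; apply: eq_bigr => i _.
  by have := @spin_at_flip R n u x i; rewrite /spin_at => ->; case: eqP => _ /=; ring.
by ring.
Qed.

Definition cw_weight n (th : R * R) (x : config n) : R :=
  expR (n%:R / 2 * th.1 * magn x ^+ 2 + n%:R * th.2 * magn x).

(** A flip moves the magnetization by 2/n, hence the exponent by at most
    2 (beta + |h|), uniformly in n. *)
Lemma cw_weight_flip n (bmax hmax : R) th u (x : config n) :
  (0 < n)%N -> Lambda_CW bmax hmax th ->
  expR (- 2 * (bmax + hmax)) * cw_weight th x <= cw_weight th (flip u x).
Proof.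
case: th => b h n0 [/andP[/= b0 bb] hh].
rewrite /cw_weight -expRD ler_expR /= magn_flip.
have n0' : n%:R != 0 :> R by rewrite pnatr_eq0 -lt0n.
have m1 := magn_norm_le1 x n0; have := magn_norm_le1 (flip u x) n0.
rewrite magn_flip; set m := magn x in m1 *; set s := spin_at x u => m2.
have s1 : `|s| = 1 by exact: spin_at_norm.
rewrite -subr_ge0.
have -> : n%:R / 2 * b * (m - 2 * s / n%:R) ^+ 2 + n%:R * h * (m - 2 * s / n%:R)
   - (- 2 * (bmax + hmax) + (n%:R / 2 * b * m ^+ 2 + n%:R * h * m)) =
   2 * (bmax + hmax) - (b * (s * (m + (m - 2 * s / n%:R))) + 2 * (h * s)).
  by field.
have h1 : b * (s * (m + (m - 2 * s / n%:R))) <= b * 2.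
  rewrite ler_wpM2l // (le_trans (ler_norm _)) // normrM s1 mul1r.
  by rewrite (le_trans (ler_normD _ _)); lra.
have h2 : h * s <= hmax.
  by rewrite (le_trans (ler_norm _)) // normrM s1 mulr1.
lra.
Qed.

Lemma curie_weiss_admissible_eps (bmax hmax : R) : 0 <= bmax -> 0 <= hmax ->
  exists eps : R, admissible_eps bmax hmax eps.
Proof.
move=> b0 h0; set c := expR (- 2 * (bmax + hmax)).
have c0 : 0 < c by exact: expR_gt0.
have c1 : c <= 1 by rewrite expR_le1; lra.
set g : R := expR (-1) * c / 4.
have g0 : 0 < g by rewrite divr_gt0 // mulr_gt0 // expR_gt0.
exists g; split => //; exists (2 * expR 1), (g / 2); split.
- by rewrite mulr_gt0 // expR_gt0.
- by rewrite divr_gt0.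
move=> n th n0 hth; set w := @cw_weight n th.
have n0' : 0 < n%:R :> R by rewrite ltr0n.
set Z := \sum_x w x.
have Z0 : 0 < Z by exact: gibbs_norm_gt0.
have gn0 : 0 <= g * n%:R / 2 by rewrite divr_ge0 // mulr_ge0 // ltW.
have /andP[N1 N2] := truncn_itv gn0.
set N := Num.trunc _ in N1 N2.
have hN : (N.+1 + N)%:R <= 1 + g * n%:R.
  by rewrite addSn -natr1 natrD; lra.
have tail b : lower_tail w b N.+1 <= expR (- N%:R) * Z.
  apply: (@lower_tail_decay R n w c) => //.
  - by move=> x; exact: expR_ge0.
  - by move=> u x; exact: cw_weight_flip.
rewrite /Pr.
set P := fun x : config n => - 1 + g <= magn x <= 1 - g.
have split1 : \sum_(x | P x) curie_weiss th x + \sum_(x | ~~ P x) curie_weiss th x = 1.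
  by rewrite -(sum_gibbs (fun x : config n => n%:R / 2 * th.1 * magn x ^+ 2
    + n%:R * th.2 * magn x)) [RHS](bigID P).
have bad : \sum_(x | ~~ P x) w x <= lower_tail w false N.+1 + lower_tail w true N.+1.
  rewrite /lower_tail [leLHS]big_mkcond [X in _ <= X + _]big_mkcond.
  rewrite [X in _ <= _ + X]big_mkcond -big_split /=; apply: ler_sum => x _.
  have w0 : 0 <= w x by exact: expR_ge0.
  case: ifPn; last by case: ifP; case: ifP; rewrite ?addr0 ?add0r ?addr_ge0.
  rewrite /P negb_and -!ltNge; have [e1 e2] := @magn_count_spin R n x n0.
  have lt_count b : 2 * (count_spin b x)%:R / n%:R < g -> (count_spin b x < N.+1)%N.
    move=> h; rewrite -(ltr_nat R); apply: le_lt_trans N2.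
    by move: h; rewrite ltr_pdivrMr // => h; lra.
  case/orP=> h.
    have -> : (count_spin true x < N.+1)%N by apply: lt_count; lra.
    by case: ifP => _; rewrite ?lerDr ?lerDl ?add0r.
  have -> : (count_spin false x < N.+1)%N by apply: lt_count; lra.
  by case: ifP => _; rewrite ?lerDr ?lerDl ?addr0.
have bad2 : \sum_(x | ~~ P x) curie_weiss th x <= 2 * expR 1 * expR (- (g / 2 * n%:R)).
  have -> : \sum_(x | ~~ P x) curie_weiss th x = (\sum_(x | ~~ P x) w x) / Z.
    by rewrite mulr_suml.
  rewrite ler_pdivrMr //; apply: (le_trans bad).
  have := tail true; have := tail false.
  have : expR (- N%:R) * Z <= expR 1 * expR (- (g / 2 * n%:R)) * Z.
    rewrite -expRD; apply: (@ler_wpM2r R Z); first exact: ltW.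
    by rewrite ler_expR; move: N2; rewrite -natr1; lra.
  by lra.
lra.
Qed.

End CurieWeissBulk.

(** * Spin swaps on a slice of fixed magnetization *)

Section ExponentialTilt.
Context {R : realType} {T : finType}.

(** From t0 to t the weight of a point with k x <= c grows at most by the factor
    e^((t - t0) c), while by Jensen's inequality the total mass grows at least by
    e^((t - t0) M), M being at most the mean of k at t0. *)
Lemma tilted_lower_tail (S : {set T}) (k : T -> R) (t0 t c M : R) : t0 <= t ->
  0 <= \sum_(x in S) expR (t0 * k x) * (k x - M) ->
  \sum_(x in S | k x <= c) expR (t * k x) <=
  expR ((t - t0) * (c - M)) * \sum_(x in S) expR (t * k x).
Proof.
move=> tt hM; set s := t - t0.
have s0 : 0 <= s by rewrite subr_ge0.
have ts x : expR (t * k x) = expR (t0 * k x) * expR (s * k x).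
  by rewrite -expRD; congr expR; rewrite /s; ring.
(* Jensen, in the form e^u >= 1 + u at u = s (k x - M). *)
have low : expR (s * M) * \sum_(x in S) expR (t0 * k x) <= \sum_(x in S) expR (t * k x).
  apply: (le_trans (y := expR (s * M) * \sum_(x in S) (expR (t0 * k x)
      + s * (expR (t0 * k x) * (k x - M))))).
    by rewrite ler_wpM2l ?expR_ge0 // big_split /= -mulr_sumr lerDl mulr_ge0.
  rewrite mulr_sumr; apply: ler_sum => x _; rewrite ts.
  have -> : s * k x = s * M + s * (k x - M) by ring.
  rewrite expRD [leRHS]mulrCA ler_pM2l ?expR_gt0 //.
  have := expR_ge1Dx (s * (k x - M)); have := expR_gt0 (t0 * k x); nra.
apply: (le_trans (y := expR (s * c) * \sum_(x in S) expR (t0 * k x))).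
  rewrite mulr_sumr big_mkcondr /=; apply: ler_sum => x _; case: ifP => h.
    by rewrite ts mulrC ler_wpM2r ?expR_ge0 // ler_expR ler_wpM2l.
  by rewrite mulr_ge0 ?expR_ge0.
have -> : s * (c - M) = s * c - s * M by ring.
rewrite expRD -mulrA ler_pM2l ?expR_gt0 //.
by rewrite -(ler_pM2l (expR_gt0 (s * M))) mulrA -expRD subrr expR0 mul1r.
Qed.

End ExponentialTilt.

Section Slices.
Context {R : realType} {n d : nat} {e : rel 'I_n}.
Hypotheses (n_gt1 : (1 < n)%N) (e_reg : regular_graph d e) (d_gt0 : (0 < d)%N).
Variable m0 : R.
Let A : 'I_n -> 'I_n -> R := @adj R n e.
Let A2 : 'I_n -> 'I_n -> R := @adj2 R n e.
Let S : {set config n} := slice n m0.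

Let n_gt0 : (0 < n)%N. Proof. exact: ltnW. Qed.
Let n1 : 0 < n%:R - 1 :> R. Proof. by rewrite subr_gt0 ltr1n. Qed.

Definition swap (p : 'I_n * 'I_n) (x : config n) : config n :=
  [ffun i => x (tperm p.1 p.2 i)].

Lemma swapK p : involutive (swap p).
Proof. by move=> x; apply/ffunP => i; rewrite !ffunE tpermK. Qed.

Lemma magn_swap p x : magn (swap p x) = magn x :> R.
Proof.
rewrite /magn; congr (_ * _).
rewrite [RHS](reindex_inj (@perm_inj _ (tperm p.1 p.2))).
by apply: eq_bigr => i _; rewrite ffunE.
Qed.

Lemma swap_slice p x : (swap p x \in S) = (x \in S).
Proof. by rewrite !inE magn_swap. Qed.

(** Centring by the magnetization makes the coordinates sum to zero on the
    slice; on regular graphs it changes kappa by a constant only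
    ([kappa_center]). *)
Definition cspin (x : config n) (i : 'I_n) : R := spin_at x i - m0.

Lemma cspin_swap p x : cspin (swap p x) =1 (fun i => cspin x (tperm p.1 p.2 i)).
Proof. by move=> i; rewrite /cspin /spin_at ffunE. Qed.

Lemma sum_cspin x : x \in S -> \sum_i cspin x i = 0.
Proof.
rewrite inE => /eqP mx; rewrite /cspin sumrB sum_spin // mx sumr_const card_ord.
by rewrite mulr_natl subrr.
Qed.

Lemma sum_cspin_sqr x : x \in S -> \sum_i cspin x i ^+ 2 = n%:R * (1 - m0 ^+ 2).
Proof.
move=> xS; transitivity (\sum_i (1 - m0 ^+ 2 - 2 * m0 * cspin x i)).
  apply: eq_bigr => i _; rewrite /cspin.
  rewrite (_ : _ ^+ 2 = spin_at x i ^+ 2 - m0 ^+ 2 - 2 * m0 * (spin_at x i - m0)).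
    by rewrite spin_at_sqr.
  by ring.
by rewrite sumrB -mulr_sumr sum_cspin // mulr0 subr0 sumr_const card_ord mulr_natl.
Qed.

Let kc (x : config n) : R := qform A (cspin x).
Let F (x : config n) : R := qform A2 (cspin x).

Lemma kappa_center x : x \in S ->
  kappa_Ising e x = kc x + d%:R * n%:R * m0 ^+ 2.
Proof.
move=> xS; rewrite kappa_IsingE.
have -> : kc x = qform A (spin_at x) - 2 * (\sum_i m0 * mulv A (spin_at x) i)
                 + qform A (fun=> m0).
  by rewrite /kc -(qformB _ _ (adj_sym e_reg)).
have c1 i : mulv A (fun=> m0) i = d%:R * m0.
  by rewrite /mulv -mulr_suml (adj_row e_reg).
have -> : qform A (fun=> m0) = n%:R * (m0 * (d%:R * m0)).
  rewrite /qform; under eq_bigr do rewrite c1.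
  by rewrite sumr_const card_ord -[LHS]mulr_natl.
rewrite -mulr_sumr (sum_mulv_adj e_reg) sum_spin //.
by move: xS; rewrite inE => /eqP ->; ring.
Qed.

Lemma energyE x : F x = \sum_i mulv A (cspin x) i ^+ 2.
Proof. exact: (qform_adj2 e_reg). Qed.

Lemma energy_ge0 x : 0 <= F x.
Proof. by rewrite energyE; apply: sumr_ge0 => i _; exact: sqr_ge0. Qed.

Lemma jump_swap_kappa u v x : jump swap kc (u, v) x =
  2 * (cspin x u - cspin x v) * (mulv A (cspin x) u - mulv A (cspin x) v)
  + 2 * A u v * (cspin x u - cspin x v) ^+ 2.
Proof.
rewrite /jump /kc (qform_swapB (adj_sym e_reg) (@cspin_swap (u, v) x)).
by rewrite !(adj_diag e_reg); ring.
Qed.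

Lemma jump_swap_energy u v x : jump swap F (u, v) x =
  2 * (cspin x u - cspin x v) *
    (mulv A (mulv A (cspin x)) u - mulv A (mulv A (cspin x)) v)
  - 2 * (d%:R - A2 u v) * (cspin x u - cspin x v) ^+ 2.
Proof.
rewrite /jump /F (qform_swapB (adj2_sym e_reg) (@cspin_swap (u, v) x)).
by rewrite !(adj2_diag e_reg) !mulv_adj2 -/A -/A2; ring.
Qed.

Lemma sum_jump_swap_kappa x : x \in S ->
  \sum_p jump swap kc p x = 4 * (n%:R - 1) * kc x + 4 * d%:R * (n%:R * (1 - m0 ^+ 2)).
Proof.
move=> xS; have := sum_swaps_qform (adj_sym e_reg) (adj_row e_reg)
  (adj_diag e_reg) (sum_cspin xS).
rewrite mul0r subr0 sum_cspin_sqr // => <-; rewrite pair_bigA /=.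
apply: eq_bigr => -[u v] _ /=; rewrite jump_swap_kappa !(adj_diag e_reg) -/A; ring.
Qed.

Lemma sum_jump_swap_energy x : x \in S ->
  \sum_p jump swap F p x =
  4 * (n%:R - 1) * F x - 4 * d%:R * (n%:R - d%:R) * (n%:R * (1 - m0 ^+ 2)).
Proof.
move=> xS; have := sum_swaps_qform (adj2_sym e_reg) (adj2_row e_reg)
  (adj2_diag e_reg) (sum_cspin xS).
rewrite sum_cspin_sqr // -/(F x) => h.
transitivity (4 * (n%:R - 1) * F x + 4 * (d%:R ^+ 2 - d%:R * n%:R) * (n%:R * (1 - m0 ^+ 2))); last by ring.
rewrite -h pair_bigA /=.
apply: eq_bigr => -[u v] _ /=.
by rewrite jump_swap_energy !(adj2_diag e_reg) !mulv_adj2 -/A -/A2; ring.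
Qed.

Let cspin_diff_le2 x u v : `|cspin x u - cspin x v| <= 2.
Proof.
have -> : cspin x u - cspin x v = spin_at x u - spin_at x v by rewrite /cspin; ring.
by rewrite (le_trans (ler_normB _ _)) // !spin_at_norm; lra.
Qed.

Let cspin_diff_sqr x u v : (cspin x u - cspin x v) ^+ 2 <= 4.
Proof.
rewrite -(real_normK (num_real _)); have := cspin_diff_le2 x u v.
by have := normr_ge0 (cspin x u - cspin x v); nra.
Qed.

Let adj_cspin_diff x u v : mulv A (cspin x) u - mulv A (cspin x) v =
   mulv A (spin_at x) u - mulv A (spin_at x) v.
Proof.
have h i : mulv A (cspin x) i = mulv A (spin_at x) i - d%:R * m0.
  by rewrite mulvB /mulv -[in X in _ - X]mulr_suml (adj_row e_reg).
by rewrite !h; ring.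
Qed.

Lemma jump_swap_kappa_norm p x : `|jump swap kc p x| <= 16 * d%:R.
Proof.
case: p => u v; rewrite jump_swap_kappa adj_cspin_diff.
have d1 : 1 <= d%:R :> R by rewrite ler1n.
have hm i : `|mulv A (spin_at x) i| <= d%:R.
  by rewrite -[leRHS]mulr1; apply: (adj_norm_le e_reg) => j; rewrite spin_at_norm.
have a0 := adj_ge0 (R := R) (e := e) u v; have a1 := adj_le1 (R := R) (e := e) u v.
have q0 := sqr_ge0 (cspin x u - cspin x v); have q1 := cspin_diff_sqr x u v.
have qq := cspin_diff_le2 x u v; have hu := hm u; have hv := hm v.
rewrite (le_trans (ler_normD _ _)) //.
have -> : 16 * d%:R = 2 * 2 * (d%:R + d%:R) + 8 * d%:R :> R by ring.
apply: lerD.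
  rewrite !normrM (ger0_norm (_ : 0 <= 2)) //; apply: ler_pM; rewrite ?mulr_ge0 //.
    by rewrite ler_pM2l.
  by rewrite (le_trans (ler_normB _ _)) // lerD.
rewrite -/(A u v) in a0 a1.
have aq : 0 <= 2 * A u v * (cspin x u - cspin x v) ^+ 2.
  by apply: mulr_ge0 => //; apply: mulr_ge0.
rewrite ger0_norm //; have : A u v * (cspin x u - cspin x v) ^+ 2 <= 1 * 4 by apply: ler_pM.
by nra.
Qed.

Let pairs_mulv_sqr (h : 'I_n -> R) : \sum_i h i = 0 ->
  \sum_u \sum_v (h u - h v) ^+ 2 = 2 * n%:R * \sum_i h i ^+ 2.
Proof.
move=> h0; have := sum_pairs_subM h h; rewrite h0 mulr0 subr0 => E.
transitivity (\sum_u \sum_v (h u - h v) * (h u - h v)).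
  by apply: eq_bigr => u _; apply: eq_bigr => v _; rewrite expr2.
by rewrite E; congr (_ * _); apply: eq_bigr => i _; rewrite expr2.
Qed.

Let sum_mulv0 x : x \in S -> \sum_i mulv A (cspin x) i = 0.
Proof. by move=> xS; rewrite (sum_mulv_adj e_reg) sum_cspin // mulr0. Qed.

Lemma sum_jump_swap_kappa_sqr_le x : x \in S ->
  \sum_p jump swap kc p x ^+ 2 <= 64 * n%:R * F x + 128 * n%:R * d%:R.
Proof.
move=> xS; set g := mulv A (cspin x).
have h u v : jump swap kc (u, v) x ^+ 2 <= 32 * (g u - g v) ^+ 2 + 128 * A u v.
  rewrite jump_swap_kappa -/g; have := cspin_diff_sqr x u v.
  set q := cspin x u - cspin x v; set b := g u - g v => q4.
  have a0 := adj_ge0 (R := R) (e := e) u v; have a1 := adj_le1 (R := R) (e := e) u v.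
  rewrite -/(A u v) in a0 a1; set a := A u v in a0 a1 *.
  have aa : a ^+ 2 <= a by nra.
  have q0 := sqr_ge0 q.
  have qq : (q ^+ 2) ^+ 2 <= 16 by nra.
  have s1 : (2 * q * b + 2 * a * q ^+ 2) ^+ 2 <=
      8 * (q ^+ 2 * b ^+ 2) + 8 * (a ^+ 2 * (q ^+ 2) ^+ 2).
    rewrite -subr_ge0 (_ : _ - _ = (2 * q * b - 2 * a * q ^+ 2) ^+ 2) ?sqr_ge0 //.
    by ring.
  have s2 : q ^+ 2 * b ^+ 2 <= 4 * b ^+ 2 by apply: ler_wpM2r; rewrite ?sqr_ge0.
  have s3 : a ^+ 2 * (q ^+ 2) ^+ 2 <= a * 16 by apply: ler_pM; rewrite ?sqr_ge0.
  by lra.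
rewrite -(pair_bigA _ (fun u v => jump swap kc (u, v) x ^+ 2)) /=.
apply: (le_trans (y := \sum_u \sum_v (32 * (g u - g v) ^+ 2 + 128 * A u v))).
  by apply: ler_sum => u _; apply: ler_sum => v _; exact: h.
have -> : \sum_u \sum_v (32 * (g u - g v) ^+ 2 + 128 * A u v) =
   32 * (\sum_u \sum_v (g u - g v) ^+ 2) + 128 * \sum_u \sum_v A u v.
  rewrite !mulr_sumr -big_split; apply: eq_bigr => u _ /=.
  by rewrite !mulr_sumr -big_split.
rewrite (pairs_mulv_sqr (sum_mulv0 xS)) -energyE.
under [X in _ + _ * X <= _]eq_bigr do rewrite (adj_row e_reg).
by rewrite sumr_const card_ord -(mulr_natl _ n); lra.
Qed.

Lemma sum_jump_swap_energy_sqr_le x : x \in S ->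
  \sum_p jump swap F p x ^+ 2 <= 64 * n%:R * d%:R ^+ 2 * F x
                                  + 128 * n%:R ^+ 2 * d%:R ^+ 2.
Proof.
move=> xS; set g := mulv A (mulv A (cspin x)).
have h u v : jump swap F (u, v) x ^+ 2 <= 32 * (g u - g v) ^+ 2 + 128 * d%:R ^+ 2.
  rewrite jump_swap_energy -/g; have := cspin_diff_sqr x u v.
  set q := cspin x u - cspin x v; set b := g u - g v => q4.
  have a0 := adj2_ge0 (R := R) (e := e) u v; have a1 := adj2_le (R := R) e_reg u v.
  rewrite -/(A2 u v) in a0 a1; set a := d%:R - A2 u v.
  have aa : a ^+ 2 <= d%:R ^+ 2 by rewrite /a; nra.
  have q0 := sqr_ge0 q.
  have qq : (q ^+ 2) ^+ 2 <= 16 by nra.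
  have s1 : (2 * q * b - 2 * a * q ^+ 2) ^+ 2 <=
      8 * (q ^+ 2 * b ^+ 2) + 8 * (a ^+ 2 * (q ^+ 2) ^+ 2).
    rewrite -subr_ge0 (_ : _ - _ = (2 * q * b + 2 * a * q ^+ 2) ^+ 2) ?sqr_ge0 //.
    by ring.
  have s2 : q ^+ 2 * b ^+ 2 <= 4 * b ^+ 2 by apply: ler_wpM2r; rewrite ?sqr_ge0.
  have s3 : a ^+ 2 * (q ^+ 2) ^+ 2 <= d%:R ^+ 2 * 16 by apply: ler_pM; rewrite ?sqr_ge0.
  by lra.
rewrite -(pair_bigA _ (fun u v => jump swap F (u, v) x ^+ 2)) /=.
apply: (le_trans (y := \sum_u \sum_v (32 * (g u - g v) ^+ 2 + 128 * d%:R ^+ 2))).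
  by apply: ler_sum => u _; apply: ler_sum => v _; exact: h.
have -> : \sum_u \sum_v (32 * (g u - g v) ^+ 2 + 128 * d%:R ^+ 2) =
   32 * (\sum_u \sum_v (g u - g v) ^+ 2) + \sum_(u < n) \sum_(v < n) 128 * d%:R ^+ 2.
  rewrite !mulr_sumr -big_split; apply: eq_bigr => u _ /=.
  by rewrite !mulr_sumr -big_split.
have g0 : \sum_i g i = 0 by rewrite (sum_mulv_adj e_reg) sum_mulv0 // mulr0.
rewrite (pairs_mulv_sqr g0).
have := sum_sqr_mulv_adj e_reg (mulv A (cspin x)).
rewrite -[X in _ <= _ * X]energyE -/g => hF.
have -> : \sum_(u < n) \sum_(v < n) 128 * d%:R ^+ 2 = n%:R * (n%:R * (128 * d%:R ^+ 2)) :> R.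
  by rewrite !sumr_const card_ord -[LHS]mulr_natl -[X in _ * X = _]mulr_natl.
have n0 : 0 <= n%:R :> R by [].
have : n%:R * (\sum_i g i ^+ 2) <= n%:R * (d%:R ^+ 2 * F x) by rewrite ler_wpM2l.
by lra.
Qed.

(** Since x_u and x_v are spins, (x_u - x_v)^2 = 2 - 2 x_u x_v; expanding, the
    only negative terms are those of the edges and n m0 sum_u x_u g_u^2, which is
    at most n |m0| |g|^2.  The factor
    1 - |m0| >= eps is what the restriction to the bulk provides. *)
Lemma sum_jump_swap_kappa_sqr_ge (eps : R) x : x \in S -> `|m0| <= 1 - eps ->
  8 * eps * n%:R * F x - 64 * n%:R * d%:R <= \sum_p jump swap kc p x ^+ 2.
Proof.
move=> xS meps; set g := mulv A (cspin x).
have h u v : 2 * ((spin_at x u - spin_at x v) ^+ 2 * (g u - g v) ^+ 2) - 64 * A u v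
      <= jump swap kc (u, v) x ^+ 2.
  rewrite jump_swap_kappa -/g; have := cspin_diff_sqr x u v.
  have -> : spin_at x u - spin_at x v = cspin x u - cspin x v by rewrite /cspin; ring.
  set q := cspin x u - cspin x v; set b := g u - g v => q4.
  have a0 := adj_ge0 (R := R) (e := e) u v; have a1 := adj_le1 (R := R) (e := e) u v.
  rewrite -/(A u v) in a0 a1; set a := A u v in a0 a1 *.
  have aa : a ^+ 2 <= a by nra.
  have q0 := sqr_ge0 q.
  have qq : (q ^+ 2) ^+ 2 <= 16 by nra.
  have s1 : 2 * (q ^+ 2 * b ^+ 2) - 4 * (a ^+ 2 * (q ^+ 2) ^+ 2) <=
     (2 * q * b + 2 * a * q ^+ 2) ^+ 2.
    rewrite -subr_ge0 (_ : _ - _ = 2 * (q * b + 2 * a * q ^+ 2) ^+ 2).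
      by rewrite mulr_ge0 ?sqr_ge0.
    by ring.
  have s3 : a ^+ 2 * (q ^+ 2) ^+ 2 <= a * 16 by apply: ler_pM; rewrite ?sqr_ge0.
  by lra.
rewrite -(pair_bigA _ (fun u v => jump swap kc (u, v) x ^+ 2)) /=.
apply: (le_trans (y := \sum_u \sum_v (2 * ((spin_at x u - spin_at x v) ^+ 2 * (g u - g v) ^+ 2) - 64 * A u v))); last first.
  by apply: ler_sum => u _; apply: ler_sum => v _; exact: h.
have g0 : \sum_i g i = 0 by exact: sum_mulv0.
have sm : \sum_i spin_at x i = n%:R * m0.
  by rewrite sum_spin //; move: xS; rewrite inE => /eqP ->.
set X := \sum_i spin_at x i * g i ^+ 2; set Y := \sum_i spin_at x i * g i.
have cross : \sum_u \sum_v spin_at x u * spin_at x v * (g u - g v) ^+ 2 =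
   2 * (n%:R * m0) * X - 2 * Y ^+ 2.
  by rewrite sum_pairs_weighted_sqr sm.
have main : \sum_u \sum_v (2 * ((spin_at x u - spin_at x v) ^+ 2 * (g u - g v) ^+ 2) - 64 * A u v)
   = 8 * n%:R * F x - 8 * (n%:R * m0) * X + 8 * Y ^+ 2 - 64 * n%:R * d%:R.
  transitivity (4 * (\sum_u \sum_v (g u - g v) ^+ 2)
     - 4 * (\sum_u \sum_v spin_at x u * spin_at x v * (g u - g v) ^+ 2)
     - 64 * (\sum_u \sum_v A u v)).
    rewrite !mulr_sumr -!sumrB; apply: eq_bigr => u _ /=.
    rewrite !mulr_sumr -!sumrB; apply: eq_bigr => v _ /=.
    have e1 := spin_at_sqr (R := R) x u; have e2 := spin_at_sqr (R := R) x v.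
    have -> : (spin_at x u - spin_at x v) ^+ 2 = 2 - 2 * (spin_at x u * spin_at x v) :> R.
      by rewrite sqrrB e1 e2; ring.
    by ring.
  rewrite cross (pairs_mulv_sqr g0) -energyE.
  under [X in _ - _ * X = _]eq_bigr do rewrite (adj_row e_reg).
  by rewrite sumr_const card_ord -(mulr_natl _ n); ring.
rewrite main.
have hX : m0 * X <= (1 - eps) * F x.
  rewrite (le_trans (ler_norm _)) // normrM ler_pM // /X energyE.
  rewrite (le_trans (ler_norm_sum _ _ _)) //; apply: ler_sum => i _.
  by rewrite normrM spin_at_norm mul1r ger0_norm ?sqr_ge0.
have n0 : 0 <= n%:R :> R by [].
have : n%:R * (m0 * X) <= n%:R * ((1 - eps) * F x) by rewrite ler_wpM2l.
by have := sqr_ge0 Y; lra.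
Qed.

Hypothesis dn_le : (2 * d <= n)%N.
Variable eps : R.
Hypotheses (eps_gt0 : 0 < eps) (eps_le1 : eps <= 1) (m0_bulk : `|m0| <= 1 - eps).

Let d1 : 1 <= d%:R :> R. Proof. by rewrite ler1n. Qed.
Let n2 : 2 <= n%:R :> R. Proof. by rewrite ler_nat. Qed.
Let dn : 2 * d%:R <= n%:R :> R. Proof. by rewrite -natrM ler_nat. Qed.

Let m0_sqr : eps <= 1 - m0 ^+ 2 <= 1.
Proof.
have e0 := eps_gt0; have e1 := eps_le1.
have h0 := normr_ge0 m0; have h1 := m0_bulk; rewrite -(real_normK (num_real m0)).
have h2 : 0 <= `|m0| ^+ 2 by exact: sqr_ge0.
have h3 : `|m0| ^+ 2 <= `|m0| * (1 - eps) by rewrite expr2 ler_wpM2l.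
have h4 : `|m0| * (1 - eps) <= 1 * (1 - eps) by rewrite ler_wpM2r //; lra.
by apply/andP; split; lra.
Qed.

(** The mean of the centred kappa under the uniform law on the slice; it is not
    zero because distinct spins are slightly anticorrelated there. *)
Let mu : R := - (d%:R * (n%:R * (1 - m0 ^+ 2)) / (n%:R - 1)).

Let sum_jump_kc x : x \in S -> \sum_p jump swap kc p x = 4 * (n%:R - 1) * (kc x - mu).
Proof.
move=> xS; rewrite sum_jump_swap_kappa // /mu; field.
by rewrite gt_eqF.
Qed.

Section Tilted.
Variable t : R.
Hypotheses (t_ge0 : 0 <= t) (td_le : 128 * (t * d%:R) <= eps).
Let w x := expR (t * kc x).
Let Z := \sum_(x in S) w x.

Let small p x : x \in S -> `|t * jump swap kc p x| <= 2^-1.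
Proof.
move=> _; rewrite normrM ger0_norm //.
have : t * `|jump swap kc p x| <= t * (16 * d%:R).
  by rewrite ler_wpM2l // jump_swap_kappa_norm.
by have := eps_le1; have := td_le; lra.
Qed.

Let Z_ge0 : 0 <= Z.
Proof. by apply: sumr_ge0 => x _; exact: expR_ge0. Qed.

Let sumwD (f g : config n -> R) :
  \sum_(x in S) w x * (f x + g x) = \sum_(x in S) w x * f x + \sum_(x in S) w x * g x.
Proof. by rewrite -big_split; apply: eq_bigr => x _ /=; rewrite mulrDr. Qed.

Let sumwZ (f : config n -> R) c :
  \sum_(x in S) w x * (c * f x) = c * \sum_(x in S) w x * f x.
Proof. by rewrite mulr_sumr; apply: eq_bigr => x _ /=; rewrite mulrCA. Qed.

Let sumwC c : \sum_(x in S) w x * c = c * Z.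
Proof. by rewrite -mulr_suml mulrC. Qed.

(** At t = 0 the mean energy on the slice is about n d (1 - m0^2).  The tilt
    perturbs the identity for its jumps by a multiple of td times the energy
    plus n, which is negligible when td is small against eps. *)
Lemma tilted_swap_energy_ge :
  d%:R * eps * n%:R / 5 * Z <= \sum_(x in S) w x * F x.
Proof.
have d0 : 0 < d%:R :> R by rewrite ltr0n.
have := tilted_sum_jump_le swapK swap_slice t_ge0 small F d0.
rewrite -/w; under eq_bigr => x xS do rewrite (sum_jump_swap_energy xS).
rewrite sumwD (sumwZ F) sumwC -/w; set EF := \sum_(x in S) w x * F x.
have EF0 : 0 <= EF.
  by apply: sumr_ge0 => x _; rewrite mulr_ge0 ?expR_ge0 ?energy_ge0.
set rhs := \sum_(x in S) _.
have rhs_le : rhs <= d%:R * (128 * n%:R * EF + 128 * n%:R ^+ 2 * Z + 128 * n%:R * d%:R * Z).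
  apply: (le_trans (y := \sum_(x in S) w x * (d%:R * (128 * n%:R * F x)
      + d%:R * (128 * n%:R ^+ 2 + 128 * n%:R * d%:R)))).
    apply: ler_sum => x xS; rewrite ler_wpM2l ?expR_ge0 //.
    have h1 : d%:R^-1 * (\sum_p jump swap F p x ^+ 2) <=
       d%:R * (64 * n%:R * F x + 128 * n%:R ^+ 2).
      rewrite ler_pdivrMl // (le_trans (sum_jump_swap_energy_sqr_le xS)) //.
      by rewrite le_eqVlt; apply/orP; left; apply/eqP; ring.
    have h2 : d%:R * (\sum_p jump swap kc p x ^+ 2) <=
       d%:R * (64 * n%:R * F x + 128 * n%:R * d%:R).
      by rewrite ler_wpM2l // sum_jump_swap_kappa_sqr_le.
    by lra.
  rewrite sumwD sumwC (sumwZ (fun x => 128 * n%:R * F x)) (sumwZ F) -/EF.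
  by lra.
rewrite ler_norml => /andP[lo _].
have {}rhs_le : t / 2 * rhs <= eps / 2 * (n%:R * EF + 2 * (n%:R ^+ 2 * Z)).
  apply: (le_trans (y := t / 2 * (d%:R * (128 * n%:R * EF + 128 * n%:R ^+ 2 * Z
                                           + 128 * n%:R * d%:R * Z)))).
    by rewrite ler_wpM2l ?divr_ge0.
  rewrite (_ : t / 2 * _ = 128 * (t * d%:R) / 2 *
     (n%:R * EF + n%:R * (n%:R * Z) + n%:R * (d%:R * Z))); last by ring.
  apply: ler_pM => //; rewrite ?divr_ge0 ?mulr_ge0 //.
  - by rewrite !addr_ge0 ?mulr_ge0.
  - by rewrite ler_pM2r.
  - have : n%:R * (d%:R * Z) <= n%:R * (n%:R * Z).
      by rewrite ler_wpM2l // ler_wpM2r //; move: dn; have := d1; lra.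
    by lra.
have base : d%:R * eps * n%:R ^+ 2 * 2 * Z
     <= 4 * d%:R * (n%:R - d%:R) * (n%:R * (1 - m0 ^+ 2)) * Z.
  rewrite ler_wpM2r //; have /andP[me _] := m0_sqr.
  have h1 : n%:R * eps <= n%:R * (1 - m0 ^+ 2) by rewrite ler_wpM2l.
  have h2 : 2 * (d%:R * n%:R) <= 4 * d%:R * (n%:R - d%:R) :> R.
    rewrite -subr_ge0 (_ : _ - _ = 2 * d%:R * (n%:R - 2 * d%:R)); last by ring.
    by rewrite !mulr_ge0 // subr_ge0.
  have p1 : 0 <= 2 * (d%:R * n%:R) :> R by rewrite !mulr_ge0.
  have p2 : 0 <= n%:R * eps by rewrite mulr_ge0 // ltW.
  have := ler_pM p1 p2 h2 h1; lra.
have Zd : eps * (n%:R ^+ 2 * Z) <= d%:R * eps * n%:R ^+ 2 * Z.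
  rewrite -subr_ge0 (_ : _ - _ = (d%:R - 1) * (eps * (n%:R ^+ 2 * Z))); last by ring.
  by apply: mulr_ge0; rewrite ?subr_ge0 // !mulr_ge0 // ?ltW.
have fin : n%:R * (d%:R * eps * n%:R * Z) <= n%:R * (5 * EF).
  have coef : eps / 2 * (n%:R * EF) <= 2^-1 * (n%:R * EF).
    by rewrite ler_wpM2r ?mulr_ge0 //; have e1 := eps_le1; lra.
  have nEF : 0 <= n%:R * EF by rewrite mulr_ge0.
  by lra.
have np : 0 < n%:R :> R by rewrite ltr0n.
by move: fin; rewrite ler_pM2l // => fin; lra.
Qed.

Hypothesis n_large : 107 <= n%:R * eps ^+ 2.

(** The drift of the mean of kappa is proportional to t times the sum of its
    squared jumps, and that sum is at least of order eps n times the energy.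
    The condition on n absorbs the contribution of swaps along edges. *)
Lemma tilted_swap_kappa_ge :
  0 <= \sum_(x in S) w x * (kc x - (mu + t * eps ^+ 2 * n%:R * d%:R / 16)).
Proof.
have := tilted_sum_jump_self_ge swapK swap_slice t_ge0 small.
rewrite -/w; under [leRHS]eq_bigr => x xS do rewrite (sum_jump_kc xS).
rewrite (sumwZ (fun x => kc x - mu)).
set E := \sum_(x in S) w x * (kc x - mu); set D := \sum_(x in S) _ => h.
have D_ge : eps ^+ 2 * n%:R ^+ 2 * d%:R * Z <= D.
  apply: (le_trans (y := \sum_(x in S) w x * (8 * eps * n%:R * F x + - (64 * n%:R * d%:R)))).
    rewrite sumwD sumwC (sumwZ F).
    have h1 := tilted_swap_energy_ge.
    have h2 : 8 * eps * n%:R * (d%:R * eps * n%:R / 5 * Z) <=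
       8 * eps * n%:R * \sum_(x in S) w x * F x.
      by rewrite ler_wpM2l // !mulr_ge0 // ltW.
    have h3 : 107 * (n%:R * d%:R * Z) <= n%:R * eps ^+ 2 * (n%:R * d%:R * Z).
      by rewrite ler_wpM2r // !mulr_ge0.
    have h4 : 0 <= n%:R * d%:R * Z by rewrite !mulr_ge0.
    by lra.
  apply: ler_sum => x xS; rewrite ler_wpM2l ?expR_ge0 //.
  exact: sum_jump_swap_kappa_sqr_ge.
have h2 : t / 4 * (eps ^+ 2 * n%:R ^+ 2 * d%:R * Z) <= 4 * (n%:R - 1) * E.
  by apply: le_trans h; rewrite ler_wpM2l ?divr_ge0.
have -> : \sum_(x in S) w x * (kc x - (mu + t * eps ^+ 2 * n%:R * d%:R / 16)) =
   E - t * eps ^+ 2 * n%:R * d%:R / 16 * Z.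
  rewrite -sumwC -sumrB; apply: eq_bigr => x _; ring.
rewrite subr_ge0 -(ler_pM2l (_ : 0 < 4 * (n%:R - 1))); last by rewrite mulr_gt0.
apply: le_trans h2.
set u := t * eps ^+ 2 * n%:R * d%:R * Z.
have u0 : 0 <= u by rewrite !mulr_ge0 // ltW.
rewrite (_ : t / 4 * _ = n%:R / 4 * u); last by rewrite /u; ring.
rewrite (_ : 4 * _ * _ = (n%:R - 1) / 4 * u); last by rewrite /u; field.
by rewrite ler_wpM2r //; lra.
Qed.

End Tilted.
Let sum_jump_one (f : config n -> R) : \sum_(x in S) \sum_p jump swap f p x = 0.
Proof.
have := sum_jump_symmetrize swapK swap_slice (fun=> 1) f.
under eq_bigr do rewrite mul1r; move=> ->.
rewrite big1 ?mulr0 // => x _; rewrite big1 // => p _.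
by rewrite /jump subrr mul0r.
Qed.

Lemma slice_sum_centered : \sum_(x in S) (kc x - mu) = 0.
Proof.
have := sum_jump_one kc; under eq_bigr => x xS do rewrite (sum_jump_kc xS).
rewrite -mulr_sumr => /eqP; rewrite mulf_eq0 => /orP[|/eqP //].
by rewrite mulf_eq0 pnatr_eq0 /= gt_eqF.
Qed.

Lemma slice_sum_energy_le : \sum_(x in S) F x <= n%:R * d%:R * #|S|%:R.
Proof.
have := sum_jump_one F; under eq_bigr => x xS do rewrite (sum_jump_swap_energy xS).
rewrite sumrB -mulr_sumr sumr_const -[X in _ - X]mulr_natl => /eqP.
rewrite subr_eq0 => /eqP E.
have p4 : 0 < 4 * (n%:R - 1) :> R by rewrite mulr_gt0.
rewrite -(ler_pM2l p4) E.
have /andP[me m1] := m0_sqr.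
have h1 : n%:R * (1 - m0 ^+ 2) <= n%:R * 1 by rewrite ler_wpM2l.
have h0 : 0 <= n%:R * (1 - m0 ^+ 2).
  by rewrite mulr_ge0 //; have e0 := eps_gt0; lra.
have h2 : 4 * d%:R * (n%:R - d%:R) <= 4 * d%:R * (n%:R - 1) :> R.
  by rewrite ler_wpM2l ?mulr_ge0 // lerB.
have h3 : 0 <= 4 * d%:R * (n%:R - d%:R) :> R.
  by rewrite !mulr_ge0 // subr_ge0; have := dn; have := d1; lra.
have h4 := ler_pM h3 h0 h2 h1.
have := ler_wpM2l (ler0n R #|S|) h4; lra.
Qed.

(** The Poincare identity for an eigenfunction: 4(n - 1) times the variance is
    half the mean of the squared jumps, itself bounded through the energy. *)
Lemma slice_sum_sqr_le : \sum_(x in S) (kc x - mu) ^+ 2 <= 32 * n%:R * d%:R * #|S|%:R.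
Proof.
have := sum_jump_symmetrize swapK swap_slice kc kc.
under eq_bigr => x xS do rewrite (sum_jump_kc xS).
under [in RHS]eq_bigr => x xS do under eq_bigr do rewrite -expr2.
have -> : \sum_(x in S) kc x * (4 * (n%:R - 1) * (kc x - mu)) =
   4 * (n%:R - 1) * \sum_(x in S) (kc x - mu) ^+ 2.
  transitivity (4 * (n%:R - 1) * (\sum_(x in S) (kc x - mu) ^+ 2 + mu * \sum_(x in S) (kc x - mu))).
    by rewrite !mulr_sumr -big_split mulr_sumr; apply: eq_bigr => x _ /=; ring.
  by rewrite slice_sum_centered mulr0 addr0.
set V := \sum_(x in S) (kc x - mu) ^+ 2 => E.
have hD : \sum_(x in S) \sum_p jump swap kc p x ^+ 2 <= 128 * n%:R ^+ 2 * d%:R * #|S|%:R.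
  apply: (le_trans (y := \sum_(x in S) (64 * n%:R * F x + 128 * n%:R * d%:R))).
    by apply: ler_sum => x xS; exact: sum_jump_swap_kappa_sqr_le.
  rewrite big_split /= -mulr_sumr sumr_const -[X in _ + X]mulr_natl.
  have h1 : 64 * n%:R * (\sum_(x in S) F x) <= 64 * n%:R * (n%:R * d%:R * #|S|%:R).
    by rewrite ler_wpM2l ?mulr_ge0 // slice_sum_energy_le.
  have h3 : 2 * (n%:R * d%:R * #|S|%:R) <= n%:R * (n%:R * d%:R * #|S|%:R) :> R.
    by rewrite ler_wpM2r ?mulr_ge0.
  by lra.
have p4 : 0 < 4 * (n%:R - 1) :> R by rewrite mulr_gt0.
rewrite -(ler_pM2l p4) E.
have h3 : 2 * (n%:R * d%:R * #|S|%:R) <= n%:R * (n%:R * d%:R * #|S|%:R) :> R.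
  by rewrite ler_wpM2r ?mulr_ge0.
by lra.
Qed.

Hypothesis n_large : 107 <= n%:R * eps ^+ 2.
Let k (x : config n) : R := kappa_Ising e x.
Let mk : R := mu + d%:R * n%:R * m0 ^+ 2.

Lemma slice_mean_kappa : (0 < #|S|)%N -> slice_mean m0 k = mk.
Proof.
move=> S0; have S0' : #|S|%:R != 0 :> R by rewrite pnatr_eq0 -lt0n.
rewrite /slice_mean -/S; apply: (mulIf S0'); rewrite divfK //.
under eq_bigr => x xS do rewrite /k (kappa_center xS).
transitivity (\sum_(x in S) (kc x - mu) + \sum_(x in S) mk).
  by rewrite -big_split; apply: eq_bigr => x _; rewrite /mk /=; ring.
by rewrite slice_sum_centered add0r sumr_const -[LHS]mulr_natl mulrC.
Qed.

Lemma slice_var_kappa : (0 < #|S|)%N ->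
  slice_var m0 k * #|S|%:R = \sum_(x in S) (kc x - mu) ^+ 2.
Proof.
move=> S0; have S0' : #|S|%:R != 0 :> R by rewrite pnatr_eq0 -lt0n.
rewrite /slice_var slice_mean_kappa // {1}/slice_mean -/S divfK //.
by apply: eq_bigr => x xS; rewrite /k (kappa_center xS) /mk; congr (_ ^+ 2); ring.
Qed.

(** The deviation T is less than half of the gain in mean at t0 = b / D, measured
    with the variance bound sqrt(32 nd) <= 6 D.  If kappa is constant on the
    slice, it equals its mean and the event is still below the level c used in
    the proof. *)
Lemma slice_miss_le (b t : R) : let D := Num.sqrt (n * d)%:R in
  0 <= b -> 2 * (b / D) <= t -> 128 * (b / D * d%:R) <= eps ->
  \sum_(x in S | ~~ (eps ^+ 2 * b / 224 <=
      (k x - slice_mean (magn x) k) / Num.sqrt (slice_var (magn x) k)))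
     expR (t * k x) <=
  expR (- (eps ^+ 2 * b ^+ 2 / 32)) * \sum_(x in S) expR (t * k x).
Proof.
move=> D b0 tb bd; set T := eps ^+ 2 * b / 224.
have D0 : 0 < D by rewrite sqrtr_gt0 ltr0n muln_gt0 n_gt0.
have DD : D ^+ 2 = n%:R * d%:R by rewrite sqr_sqrtr ?ler0n // natrM.
have T0 : 0 <= T by rewrite /T !mulr_ge0 // ltW.
have [S0|S0] := posnP #|S|.
  have Se x : (x \in S) = false by apply/negbTE; have /cards0_eq -> := S0; rewrite inE.
  rewrite big_pred0 => [|x]; last by rewrite Se.
  by rewrite big_pred0 ?mulr0 // => x; rewrite Se.
have S0' : 0 < #|S|%:R :> R by rewrite ltr0n.
set v := slice_var m0 k.
have vE := slice_var_kappa S0; rewrite -/v in vE.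
have v_ge0 : 0 <= v.
  rewrite -(pmulr_lge0 _ S0') vE; apply: sumr_ge0 => x _; exact: sqr_ge0.
have v_le : Num.sqrt v <= 6 * D.
  have D6 : 0 <= 6 * D by rewrite mulr_ge0 // ltW.
  rewrite -(ler_pXn2r (n := 2)) ?nnegrE ?sqrtr_ge0 // sqr_sqrtr // exprMn DD.
  rewrite -(ler_pM2r S0') vE (le_trans slice_sum_sqr_le) //.
  have : 0 <= n%:R * d%:R * #|S|%:R :> R by rewrite !mulr_ge0.
  by lra.
set c := mu + T * (6 * D).
set t0 := b / D in tb bd.
have t00 : 0 <= t0 by rewrite divr_ge0 // ltW.
have tt : t0 <= t by lra.
have miss x : x \in S -> ~~ (T <= (k x - slice_mean (magn x) k) /
    Num.sqrt (slice_var (magn x) k)) -> kc x <= c.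
  move=> xS; have := xS; rewrite inE => /eqP ->; rewrite slice_mean_kappa // -/v.
  rewrite /k (kappa_center xS) /mk -ltNge.
  have -> : kc x + d%:R * n%:R * m0 ^+ 2 - (mu + d%:R * n%:R * m0 ^+ 2) = kc x - mu.
    by ring.
  have [v0 _|v0] := eqVneq v 0.
    have : \sum_(x in S) (kc x - mu) ^+ 2 == 0 by rewrite -vE v0 mul0r.
    rewrite psumr_eq0 => [/allP/(_ x)|y _]; last exact: sqr_ge0.
    rewrite mem_index_enum xS /= sqrf_eq0 subr_eq0 => /(_ isT)/eqP ->.
    by rewrite /c lerDl !mulr_ge0 // ltW.
  have vp : 0 < Num.sqrt v by rewrite sqrtr_gt0 lt0r v0.
  rewrite ltr_pdivrMr // => h.
  have : T * Num.sqrt v <= T * (6 * D) by rewrite ler_wpM2l.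
  by rewrite /c; lra.
have shift x : x \in S -> expR (t * k x) = expR (t * (d%:R * n%:R * m0 ^+ 2)) * expR (t * kc x).
  by move=> xS; rewrite -expRD /k (kappa_center xS); congr expR; ring.
rewrite [X in _ <= _ * X](eq_bigr _ shift) -mulr_sumr mulrCA.
rewrite (eq_bigr (fun x => expR (t * (d%:R * n%:R * m0 ^+ 2)) * expR (t * kc x))); last first.
  by move=> x /andP[xS _]; exact: shift.
rewrite -mulr_sumr ler_pM2l ?expR_gt0 //.
apply: (le_trans (y := \sum_(x in S | kc x <= c) expR (t * kc x))).
  rewrite big_mkcondr [leRHS]big_mkcondr /=; apply: ler_sum => x xS.
  case: ifPn => [/(miss x xS) ->|_] //; case: ifP => // _; exact: expR_ge0.
have tail := tilted_lower_tail c tt (tilted_swap_kappa_ge t00 bd n_large).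
apply: (le_trans tail); apply: ler_wpM2r.
  by apply: sumr_ge0 => x _; exact: expR_ge0.
rewrite ler_expR; set M := _ + _ / 16.
have bE : t0 * D = b by rewrite divfK // gt_eqF.
(* 1/16 is the gain in mean and 6/224 the deviation, in units of b D eps^2. *)
have cM : c - M = - (b * D * eps ^+ 2) * (16^-1 - 6 / 224).
  have -> : M = mu + t0 * eps ^+ 2 * (n%:R * d%:R) / 16 by rewrite /M; ring.
  by rewrite /c /T -DD -bE; field.
rewrite cM.
apply: (le_trans (y := - ((t - t0) * (b * D * eps ^+ 2 / 32)))).
  rewrite -subr_ge0 (_ : _ - _ =
    (t - t0) * (b * D * eps ^+ 2 * (16^-1 - 6 / 224 - 32^-1))); last by ring.
  by rewrite mulr_ge0 ?subr_ge0 // mulr_ge0; [|rewrite !mulr_ge0 // ltW|lra].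
rewrite lerN2 (_ : eps ^+ 2 * b ^+ 2 / 32 = t0 * (b * D * eps ^+ 2 / 32)).
  by apply: ler_wpM2r; [rewrite !mulr_ge0 // ltW|lra].
rewrite (_ : t0 * _ = t0 * D * (b * eps ^+ 2 / 32)); last by ring.
by rewrite bE; ring.
Qed.

End Slices.

(** * Errors of the canonical test for given n *)

Section CanonicalTest.
Context {R : realType} {n : nat}.
Hypothesis n_gt0 : (0 < n)%N.

Let n0 : 0 < n%:R :> R. Proof. by rewrite ltr0n. Qed.

Lemma mem_magn_bulk (eps : R) (x : config n) :
  (magn x \in magn_bulk eps n) = (- 1 + eps <= magn x <= 1 - eps).
Proof.
rewrite mem_filter andb_idr // => _; apply/mapP; exists (count_spin true x).
  rewrite mem_iota add0n ltnS /= /count_spin.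
  by rewrite -[X in (_ <= X)%N](card_ord n) -sum1_card; apply: leq_sum => i _; case: eqP.
by have [_] := magn_count_spin (R := R) x n_gt0.
Qed.

Lemma sum_slices (f : config n -> R) :
  \sum_x f x = \sum_(j < n.+1) \sum_(x in slice n (- 1 + 2 * j%:R / n%:R : R)) f x.
Proof.
have cn (x : config n) : (count_spin true x < n.+1)%N.
  rewrite ltnS /count_spin -[X in (_ <= X)%N](card_ord n) -sum1_card.
  by apply: leq_sum => i _; case: eqP.
rewrite (partition_big (fun x => Ordinal (cn x)) predT) //=.
apply: eq_bigr => j _; apply: eq_bigl => x; rewrite inE -val_eqE /=.
have [_ ->] := magn_count_spin (R := R) x n_gt0.
have cancel a : 2 * a / n%:R * (n%:R / 2) = a :> R by field; rewrite gt_eqF.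
apply/eqP/eqP => [-> //|/addrI/(congr1 (fun z => z * (n%:R / 2)))].
by rewrite !cancel => /eqP; rewrite eqr_nat => /eqP.
Qed.

(** When the variance vanishes the quotient is 0 by convention, below T. *)
Lemma slice_chebyshev (m0 T : R) (k : config n -> R) : 0 < T ->
  \sum_(x in slice n m0) (T <= (k x - slice_mean m0 k) / Num.sqrt (slice_var m0 k))%R%:R
  <= T ^- 2 * #|slice n m0|%:R.
Proof.
move=> T0; set S := slice n m0; set mu := slice_mean m0 k; set v := slice_var m0 k.
have [S0|S0] := posnP #|S|.
  rewrite big_pred0 => [|x]; first by rewrite S0 mulr0.
  by move/cards0_eq: S0 => ->; rewrite inE.
have S0' : 0 < #|S|%:R :> R by rewrite ltr0n.
have vE : v * #|S|%:R = \sum_(x in S) (k x - mu) ^+ 2.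
  by rewrite /v /slice_var {1}/slice_mean -/S -/mu divfK // gt_eqF.
have v_ge0 : 0 <= v.
  by rewrite -(pmulr_lge0 _ S0') vE; apply: sumr_ge0 => x _; exact: sqr_ge0.
have [v0|v0] := eqVneq v 0.
  rewrite big1 ?mulr_ge0 ?invr_ge0 ?exprn_ge0 // ?ltW // => x _.
  by rewrite v0 sqrtr0 invr0 mulr0 leNgt T0.
have vp : 0 < v by rewrite lt0r v0.
have sv : 0 < Num.sqrt v by rewrite sqrtr_gt0.
have Tv : 0 < T ^+ 2 * v by apply: mulr_gt0 => //; apply: exprn_gt0.
apply: (le_trans (y := \sum_(x in S) (T ^+ 2 * v)^-1 * (k x - mu) ^+ 2)).
  apply: ler_sum => x _; case: (boolP (T <= _)) => [|_] /=; last first.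
    by rewrite mulr_ge0 ?sqr_ge0 // invr_ge0 mulr_ge0 ?sqr_ge0.
  rewrite ler_pdivlMr // => h.
  rewrite mulrC ler_pdivlMr // mul1r.
  rewrite -[X in _ * X](sqr_sqrtr v_ge0) -exprMn ler_pXn2r ?nnegrE //.
    by rewrite mulr_ge0 // ltW.
  by apply: le_trans h; rewrite mulr_ge0 // ltW.
rewrite -mulr_sumr -vE le_eqVlt; apply/orP; left; apply/eqP; field.
by rewrite !gt_eqF.
Qed.

Lemma curie_weiss_slice (th : R * R) (m0 : R) (x : config n) : x \in slice n m0 ->
  curie_weiss th x = expR (n%:R / 2 * th.1 * m0 ^+ 2 + n%:R * th.2 * m0) /
     \sum_(y : config n) expR (n%:R / 2 * th.1 * magn y ^+ 2 + n%:R * th.2 * magn y).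
Proof. by rewrite inE => /eqP mx; rewrite /curie_weiss /gibbs mx. Qed.

(** The Curie-Weiss law is constant on slices, so the bound on each slice is
    Chebyshev's inequality for the uniform law. *)
Lemma canonical_false_alarm_le (bmax hmax eps B C T : R) (k : config n -> R) th :
  0 < T -> Lambda_CW bmax hmax th ->
  1 - B * expR (- (C * n%:R)) <=
    Pr (curie_weiss (n := n) th) (fun x => - 1 + eps <= magn x <= 1 - eps) ->
  \sum_(x | canonical_test eps T k x) curie_weiss th x <=
  B * expR (- (C * n%:R)) + T ^- 2.
Proof.
move=> T0 hth hbulk; set p := curie_weiss th.
have p0 x : 0 <= p x by exact: ltW (gibbs_gt0 _ _).
have p1 : \sum_x p x = 1 by exact: sum_gibbs.
pose cond x := T <= (k x - slice_mean (magn x) k) / Num.sqrt (slice_var (magn x) k).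
pose bulk (x : config n) := - 1 + eps <= magn x <= 1 - eps.
apply: (le_trans (y := \sum_(x | ~~ bulk x) p x + \sum_x p x * (cond x)%:R)).
  rewrite [leLHS]big_mkcond [X in _ <= X + _]big_mkcond -big_split /=.
  apply: ler_sum => x _; rewrite /canonical_test mem_magn_bulk -/(bulk x) -/(cond x).
  by case: (bulk x); case: (cond x); rewrite /= ?(mulr1, mulr0, add0r, addr0) // lerDl.
apply: lerD.
  have hb : 1 - B * expR (- (C * n%:R)) <= \sum_(x | bulk x) p x := hbulk.
  by move: p1; rewrite (bigID bulk) /=; lra.
rewrite sum_slices.
apply: (le_trans (y := \sum_(j < n.+1) T ^- 2 *
    \sum_(x in slice n (- 1 + 2 * j%:R / n%:R : R)) p x)); last first.
  by rewrite -mulr_sumr -sum_slices p1 mulr1.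
apply: ler_sum => j _; set m0 := _ + _.
set c := expR (n%:R / 2 * th.1 * m0 ^+ 2 + n%:R * th.2 * m0) /
     \sum_(y : config n) expR (n%:R / 2 * th.1 * magn y ^+ 2 + n%:R * th.2 * magn y).
have c0 : 0 <= c.
  by rewrite divr_ge0 ?expR_ge0 // sumr_ge0 // => y _; exact: expR_ge0.
rewrite (eq_bigr (fun x => c * (T <= (k x - slice_mean m0 k) / Num.sqrt (slice_var m0 k))%R%:R)).
  rewrite [X in _ <= _ * X](eq_bigr (fun=> c * 1)) => [|x xS]; last first.
    by rewrite mulr1 /p (curie_weiss_slice _ xS).
  rewrite -!mulr_sumr mulrCA ler_wpM2l // sumr_const.
  exact: slice_chebyshev.
move=> x xS; rewrite /p (curie_weiss_slice _ xS) /cond.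
by move: xS; rewrite inE => /eqP ->.
Qed.

(** Slices outside the bulk are never missed; on the others the Ising law is
    proportional to the tilted weight, whatever the field h. *)
Lemma canonical_miss_le (d : nat) (e : rel 'I_n) (eps b beta h : R) :
  let D := Num.sqrt (n * d)%:R in
  (1 < n)%N -> regular_graph d e -> (0 < d)%N -> (2 * d <= n)%N -> 0 < eps ->
  107 <= n%:R * eps ^+ 2 -> 0 <= b -> 4 * b / D <= beta ->
  128 * (b / D * d%:R) <= eps ->
  \sum_(x | ~~ canonical_test eps (eps ^+ 2 * b / 224) (kappa_Ising e) x) ising e (beta, h) x
  <= expR (- (eps ^+ 2 * b ^+ 2 / 32)).
Proof.
move=> D n1 e_reg d0 dn eps0 nl b0 hb bd.
set T := eps ^+ 2 * b / 224; set k := kappa_Ising e; set q := ising e (beta, h).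
set rho := expR _.
have q0 x : 0 <= q x by exact: ltW (gibbs_gt0 _ _).
have q1 : \sum_x q x = 1 by exact: sum_gibbs.
rewrite -[leRHS]mulr1 -q1 big_mkcond [leLHS]sum_slices [X in _ <= _ * X]sum_slices.
rewrite mulr_sumr; apply: ler_sum => j _; set m0 := _ + _.
rewrite -big_mkcondr /=.
have [/andP[m1 m2]|out] := boolP (- 1 + eps <= m0 <= 1 - eps); last first.
  rewrite big_pred0 => [|x].
    by rewrite mulr_ge0 ?expR_ge0 ?sumr_ge0.
  apply/negbTE; rewrite negb_and negbK; apply/orP.
  have [xS|] := boolP (x \in slice n m0); [right|by left].
  rewrite /canonical_test mem_magn_bulk.
  by move: xS; rewrite inE => /eqP ->; rewrite out.
have eps1 : eps <= 1 by lra.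
have mb : `|m0| <= 1 - eps by rewrite ler_norml; apply/andP; split; lra.
set Z := \sum_(y : config n) expR (beta / 2 * k y + n%:R * h * magn y).
set c := expR (n%:R * h * m0) / Z.
have c0 : 0 <= c.
  by rewrite divr_ge0 ?expR_ge0 // sumr_ge0 // => y _; exact: expR_ge0.
have qE x : x \in slice n m0 -> q x = c * expR (beta / 2 * k x).
  rewrite inE => /eqP mx; rewrite /q /ising /gibbs /= mx expRD /c -/k -/Z.
  by rewrite -mulrA mulrC.
rewrite [X in _ <= _ * X](eq_bigr _ qE) (eq_bigr (fun x => c * expR (beta / 2 * k x))); last first.
  by move=> x /andP[xS _]; exact: qE.
rewrite -!mulr_sumr mulrCA ler_wpM2l //.
have tb : 2 * (b / D) <= beta / 2.
  by move: hb; rewrite -mulrA; lra.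
have := slice_miss_le n1 e_reg d0 dn eps0 eps1 mb nl b0 tb bd.
apply: le_trans.
rewrite big_mkcondr [leRHS]big_mkcondr /=; apply: ler_sum => x _.
rewrite /canonical_test negb_or -/k -/T.
by case: ifP => [/andP[_ ->]|_] //; case: ifP => // _; exact: expR_ge0.
Qed.

Lemma Pr_iid1 (p : config n -> R) (t : config n -> bool) (s : bool -> bool) :
  Pr_iid p (fun y : 1.-tuple (config n) => s (single_sample t y)) =
  \sum_(x | s (t x)) p x.
Proof.
rewrite /Pr_iid (reindex (fun x : config n => [tuple x])) /=.
  apply: eq_big => [x|x _]; first by rewrite /single_sample.
  by rewrite big_ord_recl big_ord0 mulr1.
exists (fun y => thead y) => [x _|y _] //.
by apply: eq_from_tnth => i; rewrite (ord1 i).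
Qed.

End CanonicalTest.

(** * Detection at strong coupling *)

Section StrongCoupling.
Context {R : realType}.
Variables (bmax hmax : R) (I : set nat) (d : nat -> nat).
Hypotheses (bmax_ge0 : 0 <= bmax) (hmax_ge0 : 0 <= hmax).
Hypothesis d_gt0 : forall n, I n -> (0 < d n)%N.
Hypothesis d_o_n : ((d n)%:R / n%:R : R) @[n --> within I \oo] --> (0 : R).
Variable eps : R.
Hypothesis eps_ok : admissible_eps bmax hmax eps.

(** The largest b allowed by the two constraints on t0 = b / sqrt(nd): twice t0
    is at most beta / 2 for every admissible beta, and 128 t0 d <= eps.  Note
    that sqrt(nd) / d = sqrt(n / d). *)
Definition tilt_scale (n : nat) (l : R) : R :=
  Num.min (l / 4) (eps / 128 * (Num.sqrt (n * d n)%:R / (d n)%:R)).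

Definition threshold (n : nat) (l : R) : R := eps ^+ 2 * tilt_scale n l / 224.

Let eps_gt0 : 0 < eps. Proof. by case: eps_ok. Qed.

Lemma near_degree_small (a : R) : 0 < a ->
  exists N, forall n, (N <= n)%N -> I n -> a * (d n)%:R <= n%:R.
Proof.
move=> a0; move/cvgrPdist_lt : d_o_n => /(_ a^-1); rewrite invr_gt0 => /(_ a0).
move=> /near_within_ooP [N hN]; exists (maxn 1 N) => n; rewrite geq_max => /andP[n0 Nn] In.
have := hN n Nn In; rewrite /= sub0r normrN ger0_norm ?divr_ge0 // => h.
have n0' : 0 < n%:R :> R by rewrite ltr0n.
by move: (ltW h); rewrite ler_pdivrMr // mulrC ler_pdivlMr // mulrC.
Qed.

Lemma tilt_scale_large (L : nat -> R) (A : R) : positive_divergent I L -> 0 < A ->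
  exists N, forall n, (N <= n)%N -> I n -> A <= tilt_scale n (L n).
Proof.
move=> [_ /cvgryPge/(_ (4 * A))/near_within_ooP [N1 h1]] A0.
pose a := 128 * A / eps.
have a0 : 0 < a by rewrite divr_gt0 // mulr_gt0.
have [N2 h2] := near_degree_small (exprn_gt0 2 a0).
exists (maxn N1 N2) => n; rewrite geq_max => /andP[n1 n2] In.
rewrite /tilt_scale le_min; apply/andP; split.
  by rewrite ler_pdivlMr // mulrC h1.
have dp : 0 < (d n)%:R :> R by rewrite ltr0n d_gt0.
have -> : A = eps / 128 * a by rewrite /a; field; rewrite gt_eqF.
rewrite ler_wpM2l ?divr_ge0 // ?(ltW eps_gt0) // ler_pdivlMr //.
have ad : 0 <= a * (d n)%:R by rewrite mulr_ge0 // ltW.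
rewrite -(ler_pXn2r (n := 2)) ?nnegrE ?sqrtr_ge0 // sqr_sqrtr ?ler0n //.
by rewrite natrM exprMn (expr2 (d n)%:R) mulrA ler_wpM2r // h2.
Qed.

Lemma threshold_diverges (L : nat -> R) : positive_divergent I L ->
  threshold n (L n) @[n --> within I \oo] --> +oo.
Proof.
move=> hL; apply/cvgryPge => A; apply/near_within_ooP.
have e2 : 0 < eps ^+ 2 by rewrite exprn_gt0.
pose A' := 224 * (`|A| + 1) / eps ^+ 2.
have A0 : 0 < A' by rewrite divr_gt0 // mulr_gt0 // ltr_wpDl.
have [N hN] := tilt_scale_large hL A0.
exists N => n Nn In; rewrite /threshold (le_trans (y := `|A| + 1)) //.
  by rewrite (le_trans (ler_norm _)) // lerDl.
have -> : `|A| + 1 = eps ^+ 2 * A' / 224 by rewrite /A'; field; rewrite gt_eqF.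
by rewrite ler_wpM2r ?invr_ge0 // ler_wpM2l ?(ltW e2) // hN.
Qed.

Lemma risk_strong_le (n : nat) (e : rel 'I_n) (l B C : R) :
  (1 < n)%N -> (0 < d n)%N -> regular_graph (d n) e -> 2 * (d n)%:R <= n%:R :> R ->
  107 <= n%:R * eps ^+ 2 -> 0 < tilt_scale n l -> 0 < B -> 0 < C ->
  (forall m theta, (0 < m)%N -> Lambda_CW bmax hmax theta ->
      1 - B * expR (- (C * m%:R)) <=
      Pr (curie_weiss (n := m) theta) (fun x => - 1 + eps <= magn x <= 1 - eps)) ->
  risk (@curie_weiss R n) (ising e) (Lambda_CW bmax hmax) (Lambda_strong hmax n (d n) l)
    (single_sample (canonical_test eps (threshold n l) (kappa_Ising e)))
  <= B * expR (- (C * n%:R)) + threshold n l ^- 2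
     + expR (- (eps ^+ 2 * tilt_scale n l ^+ 2 / 32)).
Proof.
move=> n1 d0 e_reg dn nl b0 B0 C0 hbulk; have n0 : (0 < n)%N by exact: ltnW.
have T0 : 0 < threshold n l by rewrite divr_gt0 // mulr_gt0 // exprn_gt0.
pose D : R := Num.sqrt (n * d n)%:R.
have D0 : 0 < D by rewrite sqrtr_gt0 ltr0n muln_gt0 n0.
have w0 : Lambda_CW bmax hmax (0, 0) by split; rewrite /= ?lexx ?normr0.
have w1 : Lambda_strong hmax n (d n) l (l / D, 0) by split; rewrite /= ?normr0.
apply: (risk_le w0 w1) => th hth.
  rewrite (Pr_iid1 _ _ id) /=.
  apply: le_trans (canonical_false_alarm_le n0 (kappa_Ising e) T0 hth (hbulk n th n0 hth)) _.
  by rewrite lerDl expR_ge0.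
rewrite (Pr_iid1 _ _ negb); case: th hth => beta h [/= hb _].
have dp : 0 < (d n)%:R :> R by rewrite ltr0n.
apply: (le_trans (y := expR (- (eps ^+ 2 * tilt_scale n l ^+ 2 / 32)))).
  apply: (@canonical_miss_le R n n0 (d n)) => //.
  - by rewrite -(ler_nat R) natrM.
  - exact: ltW.
  - apply: le_trans hb; rewrite ler_pM2r ?invr_gt0 // mulrC -ler_pdivlMr //.
    by rewrite ge_min lexx.
  - have : tilt_scale n l <= eps / 128 * (D / (d n)%:R) by rewrite ge_min lexx orbT.
    rewrite -(ler_pM2r (_ : 0 < 128 * ((d n)%:R / D))); last by rewrite mulr_gt0 // divr_gt0.
    rewrite [leRHS](_ : _ = eps); last by field; rewrite !gt_eqF.
    by apply: le_trans; rewrite le_eqVlt; apply/orP; left; apply/eqP; ring.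
by rewrite lerDr addr_ge0 ?mulr_ge0 ?expR_ge0 ?(ltW B0) // invr_ge0 exprn_ge0 // ltW.
Qed.

Let expRN_le (u : R) : 0 < u -> expR (- u) <= u^-1.
Proof.
move=> u0; rewrite expRN lef_pV2 ?posrE ?expR_gt0 //.
by have := expR_ge1Dx u; lra.
Qed.

Lemma canonical_test_distinguishes (L : nat -> R) (G : forall n, rel 'I_n) :
  positive_divergent I L -> (forall n, I n -> regular_graph (d n) (G n)) ->
  distinguishes I (fun n => @curie_weiss R n) (fun n => ising (G n))
    (fun _ => Lambda_CW bmax hmax)
    (fun n => Lambda_strong hmax n (d n) (L n))
    (fun n => single_sample
       (canonical_test eps (threshold n (L n)) (kappa_Ising (G n)))).
Proof.
move=> hL Greg; apply/cvgrPdist_lt => eta eta0; apply/near_within_ooP.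
have [_ [B [C [B0 C0 hbulk]]]] := eps_ok.
have e2 : 0 < eps ^+ 2 by rewrite exprn_gt0.
pose r := 1 + 4 / eta.
have r1 : 1 <= r by rewrite lerDl divr_ge0 // ltW.
have r0 : 0 < r by exact: lt_le_trans r1.
(* Each of the three error terms will be at most 1 / r. *)
have rV : r^-1 < eta / 4.
  by rewrite -[ltRHS]invf_div ltf_pV2 ?posrE ?divr_gt0 // ltrDr.
pose A := 1 + 224 * r / eps ^+ 2.
have A1 : 1 <= A by rewrite lerDl divr_ge0 ?mulr_ge0 // ltW.
have [N1 h1] := tilt_scale_large hL (lt_le_trans ltr01 A1).
have [N2 h2] := near_degree_small (ltr0n R 2).
pose N3 := (Num.trunc (B * r / C + 107 / eps ^+ 2)).+1.
exists (maxn (maxn 2 N3) (maxn N1 N2)) => n.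
rewrite !geq_max => /andP[/andP[n1 n3] /andP[nN1 nN2]] In.
have n0 : (0 < n)%N by exact: ltnW.
have n0' : 0 < n%:R :> R by rewrite ltr0n.
have big : B * r / C + 107 / eps ^+ 2 < n%:R.
  apply: (lt_le_trans (y := N3%:R)); last by rewrite ler_nat.
  have : 0 <= B * r / C + 107 / eps ^+ 2.
    by rewrite addr_ge0 // divr_ge0 ?mulr_ge0 // ltW.
  by move=> /truncn_itv /andP[].
have BC0 : 0 <= B * r / C by rewrite divr_ge0 ?mulr_ge0 // ltW.
have E0 : 0 <= 107 / eps ^+ 2 by rewrite divr_ge0 // ltW.
have bA := h1 n nN1 In; set b := tilt_scale n (L n) in bA.
have b1 : 1 <= b by exact: le_trans A1 bA.
have b0 : 0 < b by exact: lt_le_trans b1.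
have Tr : r <= threshold n (L n).
  rewrite /threshold -/b ler_pdivlMr // mulrC [leRHS]mulrC -ler_pdivrMr //.
  by apply: le_trans bA; rewrite /A lerDr.
set T := threshold n (L n) in Tr.
have T0 : 0 < T by exact: lt_le_trans Tr.
have nl : 107 <= n%:R * eps ^+ 2 by rewrite -ler_pdivrMr //; lra.
have := risk_strong_le n1 (d_gt0 In) (Greg _ In) (h2 n nN2 In) nl b0 B0 C0 hbulk.
rewrite -/T -/b; set rk := risk _ _ _ _ _ => hr.
have rk0 : 0 <= rk.
  apply: (@risk_ge0 R n 1 _ _ _ _ _ _ _ _ _ (0, 0) (L n / Num.sqrt (n * d n)%:R, 0)).
  - by move=> th x; exact: ltW (gibbs_gt0 _ _).
  - by move=> th x; exact: ltW (gibbs_gt0 _ _).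
  - by move=> th; exact: sum_gibbs.
  - by move=> th; exact: sum_gibbs.
  - by split; rewrite /= ?lexx ?normr0.
  - by split; rewrite /= ?normr0.
rewrite sub0r normrN ger0_norm //; apply: (le_lt_trans hr).
have p1 : B * expR (- (C * n%:R)) <= r^-1.
  apply: (le_trans (y := B * (C * n%:R)^-1)).
    by rewrite ler_wpM2l ?(ltW B0) // expRN_le // mulr_gt0.
  rewrite ler_pdivrMr ?mulr_gt0 // mulrC ler_pdivlMr // mulrC [leRHS]mulrC -ler_pdivrMr //.
  by rewrite mulrC; lra.
have TV : T^-1 <= r^-1 by rewrite lef_pV2.
have p2 : T ^- 2 <= r^-1.
  rewrite -exprVn expr2; apply: le_trans TV; rewrite ler_piMl ?invr_ge0 ?(ltW T0) //.
  by rewrite invf_le1 // (le_trans r1).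
have p3 : expR (- (eps ^+ 2 * b ^+ 2 / 32)) <= r^-1.
  have -> : eps ^+ 2 * b ^+ 2 / 32 = 7 * b * T by rewrite /T /threshold -/b; field.
  apply: le_trans (expRN_le _) _; first by rewrite !mulr_gt0.
  apply: le_trans TV; rewrite lef_pV2 ?posrE ?mulr_gt0 // ler_peMl ?(ltW T0) //; lra.
lra.
Qed.

End StrongCoupling.

Theorem theorem4p2 (R : realType) (bmax hmax : R)
    (bmax_ge0 : 0 <= bmax) (hmax_ge0 : 0 <= hmax)
    (I : set nat) (I_infinite : infinite_set I)
    (d : nat -> nat) (d_gt0 : forall n, I n -> (0 < d n)%N)
    (d_o_n : ((d n)%:R / n%:R : R) @[n --> within I \oo] --> (0 : R)) :
  ((exists eps : R, admissible_eps bmax hmax eps) /\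
   forall eps : R, admissible_eps bmax hmax eps ->
   exists tau : nat -> R -> R,
   forall (L : nat -> R), positive_divergent I L ->
     (tau n (L n) @[n --> within I \oo] --> +oo) /\
     forall (G : forall n, rel 'I_n),
     (forall n, I n -> regular_graph (d n) (G n)) ->
     distinguishes I (fun n => @curie_weiss R n) (fun n => ising (G n))
       (fun _ => Lambda_CW bmax hmax)
       (fun n => Lambda_strong hmax n (d n) (L n))
       (fun n => single_sample
          (canonical_test eps (tau n (L n)) (kappa_Ising (G n)))))
  /\
  (forall (L : nat -> R), positive_divergent I L ->
   forall (G : forall n, rel 'I_n),
   (forall n, I n -> regular_graph (d n) (G n)) ->
   forall k : nat,
   ~ exists t : forall n, decision n k,
     distinguishes I (fun n => @curie_weiss R n) (fun n => ising (G n))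
       (fun _ => Lambda_CW bmax hmax)
       (fun n => Lambda_weak hmax n (d n) (L n))
       t).
Proof.
split; last first.
  move=> L hL G Greg k [t].
  exact: weak_coupling_undetectable I_infinite d_gt0 hL Greg.
split; first exact: curie_weiss_admissible_eps.
move=> eps eps_ok; exists (threshold d eps) => L hL; split.
  exact (threshold_diverges d_gt0 d_o_n eps_ok hL).
move=> G Greg.
exact (canonical_test_distinguishes bmax_ge0 hmax_ge0 d_gt0 d_o_n eps_ok hL Greg).
Qed.
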